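(* Let $R(\mathbf{x},\mathbf{x}')$, where $\mathbf{x}=\{x_1,\dots,x_N\}$ for some $N\ge 1$, be an octagonal constraint defining a relation $R\subseteq\mathbb{Z}^{\mathbf{x}}\times\mathbb{Z}^{\mathbf{x}}$. Then the algorithm WNT (described in the context), run on $R$, returns an octagonal constraint $\phi(\mathbf{x})$ that defines the weakest recurrent set $\mathrm{wrs}(R)$, in at most $\mathcal{O}\big(N^4\cdot(N+\log_2\mu(R))\big)$ time. Also, $\mu(\phi)=\mathcal{O}(\mu(R)\cdot N\cdot 2^N)$.
   Context: $\mathbb{Z}^{\mathbf{x}}$ is the set of valuations $\nu:\mathbf{x}\to\mathbb{Z}$; $\mathbf{x}'=\{x_1',\dots,x_N'\}$ are primed copies. A formula over $\mathbf{x}\cup\mathbf{x}'$ defines a relation on $\mathbb{Z}^{\mathbf{x}}$ by evaluating unprimed variables with the first valuation and primed ones with the second. $R^n$ is the $n$-th relational power ($R^0$ is the identity). An octagonal constraint over a set of integer variables is a finite conjunction of atoms $u-v\le c$, $u+v\le c$, $-u-v\le c$, with $u,v$ variables (possibly equal) and $c\in\mathbb{Z}$; the inconsistent formula false is regarded as an octagonal constraint. $\mu(\phi)$ is the maximal absolute value of the constants $c$ occurring in $\phi$. For $S\subseteq\mathbb{Z}^{\mathbf{x}}$ let $\mathrm{pre}_R(S)=\{\nu\mid\exists\nu'\in S.\ (\nu,\nu')\in R\}$. A set $S$ is recurrent for $R$ if $S\subseteq\mathrm{pre}_R(S)$; $\mathrm{wrs}(R)$ is the union of all recurrent sets for $R$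 (equivalently, the set of valuations from which an infinite $R$-chain starts). Matrix encoding. An octagonal constraint over $m$ variables $v_1,\dots,v_m$ is encoded by a $2m\times 2m$ matrix $M$ over $\mathbb{Z}\cup\{\infty\}$, whose entry $M_{ij}$ is an upper bound on $y_i-y_j$, where $y_{2k-1}$ stands for $v_k$ and $y_{2k}$ for $-v_k$ (each atom gives two symmetric entries; missing bounds are $\infty$). Let $\bar\imath=i-1$ for $i$ even and $i+1$ for $i$ odd. If the constraint is consistent, its tight closure is $M^t_{ij}=\min\{M^*_{ij},\lfloor M^*_{i\bar\imath}/2\rfloor+\lfloor M^*_{\bar\jmath j}/2\rfloor\}$, where $M^*$ is the shortest-path closure of $M$ computed by the Floyd–Warshall algorithm. It is the canonical encoding of the constraint. For a consistent constraint $V(\mathbf{x},\mathbf{x}')$, ${}^{\blacksquare}M^t_V$ denotes the top-left $2N\times 2N$ block of its tightly closed matrix (the entries involving only unprimed variables); the octagonal constraint it encodes is equivalent to $\exists\mathbf{x}'.V(\mathbf{x},\mathbf{x}')$. For matrices, $M>M'$ means $M_{ij}\ge M'_{ij}$ for all $i,j$ and $M\ne M'$. Algorithm WNT. On input $R(\mathbf{x},\mathbf{x}')$: compute octagonal constraints $V$ and $W$ defining $R^{5^{2N}}$ and $R^{5^{2N}+1}$, respectively, by fast exponentiation. If $W$ is inconsistent or ${}^{\blacksquare}M^t_V>{}^{\blacksquare}M^t_W$, return false; otherwise return the octagonal constraint encoded by ${}^{\blacksquare}M^t_V$. Fast exponentiation to the power $n$: if $R$ is inconsistent, return false. Otherwise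 start with $P$ encoding $R^0$ and $Q$ encoding $R$ (tightly closed matrices). For $i=1,\dots,\lceil\log_2 n\rceil$: if $Q$ encodes an inconsistent constraint, return false; if the $i$-th least significant bit of $n$ is 1, replace $P$ by the composition of $P$ and $Q$; then replace $Q$ by the composition of $Q$ with itself. Finally return the constraint encoded by $P$. The composition of two matrices encoding $R_1,R_2$ is obtained by forming the matrix of $R_1(\mathbf{x},\mathbf{z})\wedge R_2(\mathbf{z},\mathbf{x}')$, checking consistency, tightly closing it, and deleting the rows and columns of $\mathbf{z}$ (an inconsistent matrix is returned if the conjunction is inconsistent). *)

(* Defs.v *)
From mathcomp Require Import all_boot all_order all_algebra.
From mathcomp Require Import classical_sets.

Set Implicit Arguments.
Unset Strict Implicit.
Unset Printing Implicit Defensive.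

(** * Octagonal constraints *)

Inductive atom (V : Type) : Type :=
| SubLe of V & V & int      (* u - v <= c *)
| AddLe of V & V & int      (* u + v <= c *)
| OppLe of V & V & int.     (* - u - v <= c *)

Inductive octagon (V : Type) : Type :=
| OctFalse
| OctConj of seq (atom V).
Arguments OctFalse {V}.

Definition atom_const (V : Type) (a : atom V) : int :=
  match a with SubLe _ _ c | AddLe _ _ c | OppLe _ _ c => c end.

Definition atom_sat (V : Type) (nu : V -> int) (a : atom V) : bool :=
  match a with
  | SubLe u v c => (nu u - nu v <= c)%R
  | AddLe u v c => (nu u + nu v <= c)%R
  | OppLe u v c => (- nu u - nu v <= c)%R
  end.

Definition oct_sat (V : Type) (nu : V -> int) (phi : octagon V) : bool :=
  match phi with
  | OctFalse => false
  | OctConj s => all (atom_sat nu) s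
  end.

(* An empty conjunction and [OctFalse] contain no constant: [mu] is then 0. *)
Definition mu (V : Type) (phi : octagon V) : nat :=
  match phi with
  | OctFalse => 0
  | OctConj s => \max_(a <- s) `|atom_const a|%N
  end.

(** * Relations and recurrent sets *)

Definition valuation (N : nat) : Type := 'I_N -> int.

(* [inl k] is the unprimed variable x_k, [inr k] is its primed copy. *)
Definition var2 (N : nat) : finType := ('I_N + 'I_N)%type.

Definition oct_set (N : nat) (phi : octagon 'I_N) : set (valuation N) :=
  [set nu | oct_sat nu phi]%classic.

Definition oct_rel (N : nat) (phi : octagon (var2 N)) :
    set (valuation N * valuation N) :=
  [set p | oct_sat (fun v : var2 N =>
     match v with inl k => p.1 k | inr k => p.2 k end) phi]%classic.

Definition pre (N : nat) (R : set (valuation N * valuation N))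
    (S : set (valuation N)) : set (valuation N) :=
  [set nu | exists2 nu', S nu' & R (nu, nu')]%classic.

Definition recurrent (N : nat) (R : set (valuation N * valuation N))
    (S : set (valuation N)) : Prop :=
  (S `<=` pre R S)%classic.

Definition wrs (N : nat) (R : set (valuation N * valuation N)) :
    set (valuation N) :=
  (\bigcup_(S in [set S | recurrent R S]) S)%classic.

(** * Matrix encoding *)

(* The index y_(2k-1), standing for v_k, is [(v_k, false)]; the index y_(2k),
   standing for - v_k, is [(v_k, true)]. *)
Definition lit (V : finType) : finType := (V * bool)%type.

Definition bar (V : finType) (i : lit V) : lit V := (i.1, ~~ i.2).

(* [None] is the bound +oo. *)
Definition bound : eqType := option int.

(* [M (i, j)] is an upper bound on y_i - y_j. *)
Definition dbm (V : finType) : eqType := {ffun lit V * lit V -> bound}.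

Definition badd (a b : bound) : bound :=
  match a, b with Some c, Some d => Some (c + d)%R | _, _ => None end.

Definition bmin (a b : bound) : bound :=
  match a, b with
  | Some c, Some d => Some (Num.min c d)
  | Some c, None => Some c
  | None, _ => b
  end.

(* Integer division rounds towards -oo. *)
Definition bhalf (a : bound) : bound := omap (fun c => (c %/ 2)%Z) a.

Definition ble (a b : bound) : bool :=
  match a, b with
  | _, None => true
  | None, Some _ => false
  | Some c, Some d => (c <= d)%R
  end.

Definition atom_entries (V : finType) (a : atom V) : seq (lit V * lit V) :=
  match a with
  | SubLe u v _ => [:: ((u, false), (v, false)); ((v, true), (u, true))]
  | AddLe u v _ => [:: ((u, false), (v, true)); ((v, false), (u, true))]
  | OppLe u v _ => [:: ((u, true), (v, false)); ((v, true), (u, false))]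
  end.

(* [None] represents an inconsistent matrix. *)
Definition encode (V : finType) (phi : octagon V) : option (dbm V) :=
  match phi with
  | OctFalse => None
  | OctConj s =>
      Some [ffun ij => \big[bmin/None]_(a <- s | ij \in atom_entries a)
                         Some (atom_const a)]
  end.

(* The atom equivalent to y_i - y_j <= c. *)
Definition entry_atom (V : finType) (ij : lit V * lit V) (c : int) : atom V :=
  let: ((u, s), (v, t)) := ij in
  match s, t with
  | false, false => SubLe u v c
  | false, true => AddLe u v c
  | true, false => OppLe u v c
  | true, true => SubLe v u c
  end.

Definition decode (V : finType) (M : dbm V) : octagon V :=
  OctConj (pmap (fun ij => omap (entry_atom ij) (M ij))
                (enum {: lit V * lit V})).

(** * Cost model

   A timed computation returns a value together with the number of bit
   operations spent.  Adding, comparing, halving or copying matrix entries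
   costs the total length of the operands in binary (one sign symbol included;
   a bound is never free, not even +oo), and so do the operations on the
   exponent.  Control flow and access to a matrix entry are free; every
   iteration of a loop performs at least one charged operation. *)

Definition timed (A : Type) : Type := (A * nat)%type.

Definition ret (A : Type) (a : A) : timed A := (a, 0).

Definition bind (A B : Type) (m : timed A) (f : A -> timed B) : timed B :=
  ((f m.1).1, m.2 + (f m.1).2).

Declare Scope timed_scope.
Delimit Scope timed_scope with timed.
Notation "x <- m ;; p" := (bind m (fun x => p))
  (at level 60, m at next level, right associativity) : timed_scope.
Local Open Scope timed_scope.

Definition nat_size (n : nat) : nat := (trunc_log 2 n).+1.

Definition bound_size (a : bound) : nat :=
  match a with Some c => (nat_size `|c|%N).+1 | None => 1 end.

Definition addT (a b : bound) : timed bound :=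
  (badd a b, bound_size a + bound_size b).
Definition minT (a b : bound) : timed bound :=
  (bmin a b, bound_size a + bound_size b).
Definition halfT (a : bound) : timed bound := (bhalf a, bound_size a).
Definition copyT (a : bound) : timed bound := (a, bound_size a).
Definition leT (a b : bound) : timed bool :=
  (ble a b, bound_size a + bound_size b).
Definition eqT (a b : bound) : timed bool :=
  (a == b, bound_size a + bound_size b).

(* Doubly nested loop filling a matrix. *)
Definition matrixT (V : finType) (f : lit V -> lit V -> timed bound) :
    timed (dbm V) :=
  ([ffun ij => (f ij.1 ij.2).1], \sum_(ij : lit V * lit V) (f ij.1 ij.2).2).

Definition allT (I : finType) (f : I -> timed bool) : timed bool :=
  ([forall i, (f i).1], \sum_(i : I) (f i).2).

Fixpoint foldT (I A : Type) (f : I -> A -> timed A) (s : seq I) (a : A) :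
    timed A :=
  if s is i :: s' then b <- f i a ;; foldT f s' b else ret a.

(** * Closure *)

(* Initialisation of Floyd-Warshall: the empty path has length 0. *)
Definition init_diag (V : finType) (M : dbm V) : timed (dbm V) :=
  matrixT (fun i j =>
    if i == j then minT (M (i, j)) (Some 0%R) else copyT (M (i, j))).

Definition floyd_warshall (V : finType) (M : dbm V) : timed (dbm V) :=
  D <- init_diag M ;;
  foldT (fun k (D : dbm V) =>
           matrixT (fun i j =>
             s <- addT (D (i, k)) (D (k, j)) ;; minT (D (i, j)) s))
        (enum (lit V)) D.

Definition tighten (V : finType) (D : dbm V) : timed (dbm V) :=
  matrixT (fun i j =>
    a <- halfT (D (i, bar i)) ;;
    b <- halfT (D (bar j, j)) ;;
    s <- addT a b ;;
    minT (D (i, j)) s).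

(* The constraint encoded by M is satisfiable over the integers iff the shortest
   path closure of M has no negative diagonal entry and tightening it does not
   create one.  The result is [None] in the inconsistent case. *)
Definition tight_closure (V : finType) (M : dbm V) : timed (option (dbm V)) :=
  D <- floyd_warshall M ;;
  T <- tighten D ;;
  ok <- allT (fun i => leT (Some 0%R) (T (i, i))) ;;
  ret (if ok then Some T else None).

(** * Composition and fast exponentiation *)

(* The variables x, z, x' are [inl _], [inr (inl _)], [inr (inr _)]. *)
Definition var3 (N : nat) : finType := ('I_N + var2 N)%type.

Definition in_xz (N : nat) (v : var3 N) : option (var2 N) :=
  match v with
  | inl k => Some (inl k)
  | inr (inl k) => Some (inr k)
  | inr (inr _) => None
  end.

Definition in_zx' (N : nat) (v : var3 N) : option (var2 N) :=
  match v with
  | inl _ => None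
  | inr w => Some w
  end.

Definition view_entry (V W : finType) (view : W -> option V) (M : dbm V)
    (i j : lit W) : bound :=
  match view i.1, view j.1 with
  | Some u, Some v => M ((u, i.2), (v, j.2))
  | _, _ => None
  end.

Definition submatrix (V W : finType) (f : V -> W) (M : dbm W) : timed (dbm V) :=
  matrixT (fun i j => copyT (M ((f i.1, i.2), (f j.1, j.2)))).

Definition drop_z (N : nat) (v : var2 N) : var3 N :=
  match v with inl k => inl k | inr k => inr (inr k) end.

Definition compose_dbm (N : nat) (M1 M2 : dbm (var2 N)) :
    timed (option (dbm (var2 N))) :=
  C <- matrixT (fun i j => minT (view_entry (@in_xz N) M1 i j)
                                (view_entry (@in_zx' N) M2 i j)) ;;
  oT <- tight_closure C ;;
  match oT with
  | None => ret None
  | Some T => S <- submatrix (@drop_z N) T ;; ret (Some S)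
  end.

Definition compose (N : nat) (P Q : option (dbm (var2 N))) :
    timed (option (dbm (var2 N))) :=
  match P, Q with
  | Some M1, Some M2 => compose_dbm M1 M2
  | _, _ => ret None
  end.

(* Tightly closed encoding of the identity relation, x_k = x_k' for all k. *)
Definition identity_dbm (N : nat) : timed (dbm (var2 N)) :=
  let index (v : var2 N) := match v with inl k => k | inr k => k end in
  matrixT (fun i j : lit (var2 N) =>
    copyT (if (index i.1 == index j.1) && (i.2 == j.2) then Some 0%R
           else None)).

(* Runs [r] more rounds; the bit examined is the lowest one of [n], which is
   shifted after each round. *)
Fixpoint fast_exp_loop (N : nat) (r n : nat) (P Q : option (dbm (var2 N))) :
    timed (option (dbm (var2 N))) :=
  match r with
  | 0 => ret P
  | r'.+1 =>
      if Q is None then ret None else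
      b <- (odd n, 1) ;;
      P' <- (if b then compose P Q else ret P) ;;
      Q' <- compose Q Q ;;
      n' <- (n./2, nat_size n) ;;
      fast_exp_loop r' n' P' Q'
  end.

(* [up_log 2 n] is the ceiling of log2 n. *)
Definition fast_exp (N : nat) (R : option (dbm (var2 N))) (n : nat) :
    timed (option (dbm (var2 N))) :=
  match R with
  | None => ret None
  | Some M =>
      Q <- tight_closure M ;;
      if Q is None then ret None else
      P <- identity_dbm N ;;
      r <- (up_log 2 n, nat_size n) ;;
      fast_exp_loop r n (Some P) Q
  end.

(** * The algorithm *)

Fixpoint pow5 (e : nat) : timed nat :=
  if e is e'.+1 then m <- pow5 e' ;; (5 * m, nat_size m) else (1, 1).

(* M > M' : entrywise larger or equal, and different. *)
Definition gt_dbm (V : finType) (M M' : dbm V) : timed bool :=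
  ge <- allT (fun ij => leT (M' ij) (M ij)) ;;
  eq <- allT (fun ij => eqT (M ij) (M' ij)) ;;
  ret (ge && ~~ eq).

Definition decodeT (V : finType) (M : dbm V) : timed (octagon V) :=
  (decode M, \sum_ij bound_size (M ij)).

(* If V is inconsistent then so is W, hence the last case is only "W is
   inconsistent". *)
Definition WNT (N : nat) (R : option (dbm (var2 N))) : timed (octagon 'I_N) :=
  n <- pow5 (2 * N) ;;
  n1 <- (n.+1, nat_size n) ;;
  oV <- fast_exp R n ;;
  oW <- fast_exp R n1 ;;
  match oV, oW with
  | Some MV, Some MW =>
      A <- submatrix inl MV ;;
      B <- submatrix inl MW ;;
      gt <- gt_dbm A B ;;
      if gt then ret OctFalse else decodeT A
  | _, _ => ret OctFalse
  end.

Definition WNT_output (N : nat) (R : octagon (var2 N)) : octagon 'I_N :=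
  (WNT (encode R)).1.

(* The time is that of the run on the matrix of R: the number of atoms of R may be
   arbitrarily large (redundant atoms) for given N and mu R, so building that
   matrix is not part of the run. *)
Definition WNT_time (N : nat) (R : octagon (var2 N)) : nat :=
  (WNT (encode R)).2.

(* Main.v *)
Require Import Defs.
From mathcomp Require Import classical_sets.
From mathcomp Require Import all_boot all_order all_algebra.
From mathcomp Require Import zify.

(** A tightly closed matrix describes its integer solutions exactly: solutions on
   some of the variables extend to all of them, one variable at a time, and every
   finite entry is attained, every infinite one unbounded.  Hence the matrices
   computed by fast exponentiation are determined by the powers of the relation,
   and the sizes of their entries follow from simple paths in the unfolding of a
   power.  The domains of the powers decrease; when two consecutive ones agree they
   are the weakest recurrent set.  To see that they agree after (2N)^2 steps as soon
   as the weakest recurrent set is nonempty, compute them by shortest paths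
   only: an entry that drops at step k+1 does so because of an entry that drops at
   step k, so a longer chain of drops would visit an entry twice and could be
   pumped to push that entry to -oo, against the bound given by a recurrent point.
   This yields correctness, since (2N)^2 <= 5^(2N), and the bound on the constants of
   the output, which already appear in the power (2N)^2. *)

Set Implicit Arguments.
Unset Strict Implicit.
Unset Printing Implicit Defensive.
Import Order.TTheory GRing.Theory Num.Theory.

(** * Shortest path closure *)

(** Tightening stays out of the stabilisation argument because a shortest-path entry depends
    additively, with coefficient one, on each edge of its walk: the rest of the walk is a context of
    fixed weight, which can be iterated. Halving and rounding would destroy this. Nothing is lost,
    since tightening commutes with deleting variables and keeps all integer solutions. Canonicity
    also controls the running time. Counting one extra bit per Floyd-Warshall round through all
    compositions would give entries with a number of bits quadratic in [N]. Each intermediate matrix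
    is instead identified with one read off the unfolding, which gives a size linear in [N] plus the
    logarithm of the input constants. Growth per round is counted only inside a single closure,
    where the matrix may be inconsistent and simple walks say nothing. Three facts about the
    exponents matter: they are at least the number of matrix entries, they have O(N) bits, and they
    are not powers of two. For a power of two the prescribed number of rounds would miss the leading
    bit. *)

Lemma ble_refl a : ble a a.
Proof. by case: a => //= c; apply: lexx. Qed.

Lemma ble_trans b a c : ble a b -> ble b c -> ble a c.
Proof. by case: a b c => [a|] [b|] [c|] //=; lia. Qed.

Lemma ble_anti a b : ble a b -> ble b a -> a = b.
Proof. by case: a b => [a|] [b|] //= ? ?; congr Some; lia. Qed.

Lemma ble_bminl a b : ble (bmin a b) a.
Proof. by case: a b => [a|] [b|] //=; lia. Qed.

Lemma ble_bminr a b : ble (bmin a b) b.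
Proof. by case: a b => [a|] [b|] //=; lia. Qed.

Lemma ble_bmin c a b : ble c (bmin a b) = ble c a && ble c b.
Proof. by case: c a b => [c|] [a|] [b|] //=; lia. Qed.

Lemma bminP a b : bmin a b = a \/ bmin a b = b.
Proof.
by case: a b => [a|] [b|] /=; [case: leP => _| | |]; [left|right|left|right|left].
Qed.

Lemma ble_badd a b c d : ble a c -> ble b d -> ble (badd a b) (badd c d).
Proof. by case: a b c d => [a|] [b|] [c|] [d|] //=; lia. Qed.

Lemma matrixTE (V : finType) (f : lit V -> lit V -> timed bound) i j :
  (matrixT f).1 (i, j) = (f i j).1.
Proof. by rewrite ffunE. Qed.

Lemma foldT_inv (I A : Type) (f : I -> A -> timed A) (Q : A -> Prop) s a :
  Q a -> (forall i b, Q b -> Q (f i b).1) -> Q (foldT f s a).1.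
Proof. by move=> Qa Qf; elim: s a Qa => //= i s IHs a Qa; exact/IHs/Qf. Qed.

Section Closure.
Local Open Scope ring_scope.
Variable V : finType.
Implicit Types (M D T X : dbm V) (i j k : lit V) (nu : V -> int).

Definition fw_step k D : dbm V :=
  (matrixT (fun i j => bind (addT (D (i, k)) (D (k, j)))
                            (fun s => minT (D (i, j)) s))).1.

Lemma fw_stepE k D i j :
  fw_step k D (i, j) = bmin (D (i, j)) (badd (D (i, k)) (D (k, j))).
Proof. by rewrite /fw_step matrixTE. Qed.

Definition fw M : dbm V := (floyd_warshall M).1.

Definition mx_le X D := forall i j, ble (X (i, j)) (D (i, j)).

Definition triangle D :=
  forall i k j, ble (D (i, j)) (badd (D (i, k)) (D (k, j))).

Lemma fw_le_init M : mx_le (fw M) (init_diag M).1.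
Proof.
apply: (foldT_inv (Q := fun D => mx_le D (init_diag M).1)) => [i j|k D leD i j].
  exact: ble_refl.
by apply: ble_trans (leD i j); rewrite [X in ble X _]fw_stepE ble_bminl.
Qed.

Lemma fw_le M : mx_le (fw M) M.
Proof.
move=> i j; apply: ble_trans (fw_le_init M i j) _; rewrite matrixTE.
by case: eqP => _; [apply: ble_bminl | apply: ble_refl].
Qed.

Lemma fw_diag_le M i : ble (fw M (i, i)) (Some 0).
Proof.
apply: ble_trans (fw_le_init M i i) _; rewrite matrixTE eqxx; exact: ble_bminr.
Qed.

(* Every entry of the closure is the weight of some walk, so a property of
   weights that holds for edges and is stable under concatenation holds for it. *)
Lemma fw_ind (Phi : lit V -> lit V -> int -> Prop) M :
    (forall i, Phi i i 0) ->
    (forall i j c, M (i, j) = Some c -> Phi i j c) ->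
    (forall i k j c d, Phi i k c -> Phi k j d -> Phi i j (c + d)) ->
  forall i j c, fw M (i, j) = Some c -> Phi i j c.
Proof.
move=> Phi0 PhiM PhiD.
apply: (foldT_inv (Q := fun D => forall i j c, D (i, j) = Some c -> Phi i j c)).
  move=> i j c; rewrite matrixTE; case: eqP => [<-|_]; last exact: PhiM.
  by case: (bminP (M (i, i)) (Some 0)) => /= -> => [|[<-]]; [apply: PhiM|].
move=> k D PhiDk i j c; rewrite [LHS]fw_stepE.
case: (bminP (D (i, j)) (badd (D (i, k)) (D (k, j)))) => ->; first exact: PhiDk.
case Dik: (D (i, k)) => [a|] //; case Dkj: (D (k, j)) => [b|] //= [<-].
by apply: (PhiD i k j); apply: PhiDk.
Qed.

(** The triangle inequality for [X] telescopes along the walk supplied by [fw_ind]. This extremal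
    property is how the closure is compared with other matrices: coherence, monotonicity and
    preservation of solutions each come from a suitable [X]. *)
Lemma fw_greatest X M :
  (forall i, ble (X (i, i)) (Some 0)) -> triangle X -> mx_le X M -> mx_le X (fw M).
Proof.
move=> X0 triX leXM i j; case Dij: (fw M (i, j)) => [c|]; last by case: (X _).
move: i j c Dij; apply: fw_ind => // [i j c <-|i k j c d leXc leXd].
  exact: leXM.
apply: ble_trans (triX i k j) _.
by case: (X (i, k)) (X (k, j)) leXc leXd => [x|] [y|] //=; lia.
Qed.

(** The invariant is about the matrix alone, not about paths: the inequality holds through every
    pivot in [K], the pivots already processed. Later rounds keep it because no diagonal entry is
    negative at any round. *)
Lemma fw_triangle M :
  (forall i, ble (Some 0) (fw M (i, i))) -> triangle (fw M).
Proof.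
have foldT_le s D : mx_le (foldT (fun k D => matrixT (fun i j =>
    bind (addT (D (i, k)) (D (k, j))) (fun s => minT (D (i, j)) s))) s D).1 D.
  elim: s D => [|k s IHs] D i j /=; first exact: ble_refl.
  by apply: ble_trans (IHs _ i j) _; rewrite [X in ble X _]fw_stepE ble_bminl.
have through s D (K : pred (lit V)) :
    (forall k, K k -> forall i j, ble (D (i, j)) (badd (D (i, k)) (D (k, j)))) ->
    let F := (foldT (fun k D => matrixT (fun i j =>
      bind (addT (D (i, k)) (D (k, j))) (fun s => minT (D (i, j)) s))) s D).1 in
    (forall i, ble (Some 0) (F (i, i))) ->
    forall k, K k || (k \in s) ->
      forall i j, ble (F (i, j)) (badd (F (i, k)) (F (k, j))).
  elim: s D K => [|h s IHs] D K triK F posF k; first by rewrite orbF; apply: triK.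
  rewrite inE orbA => Kk.
  (* Rounds only lower entries, so a diagonal that ends nonnegative was nonnegative all along. *)
  have posD i : ble (Some 0) (D (i, i)).
    exact: ble_trans (posF i) (foldT_le _ _ _ _).
  have IH := IHs (fw_step h D) [pred l | K l || (l == h)] _ posF k Kk; apply: IH.
  move=> l /orP[Kl|/eqP->] i j; rewrite !fw_stepE.
    move: (triK l Kl i j) (triK l Kl i h) (triK l Kl h j) (triK l Kl h h) (posD h).
    case: (D (i, j)) => [ij|]; case: (D (i, l)) => [il|]; case: (D (l, j)) => [lj|];
    case: (D (i, h)) => [ih|]; case: (D (h, j)) => [hj|]; case: (D (h, h)) => [hh|];
    case: (D (h, l)) => [hl|]; case: (D (l, h)) => [lh|] //=; lia.
  move: (posD h).
  case: (D (i, j)) => [ij|]; case: (D (i, h)) => [ih|]; case: (D (h, j)) => [hj|];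
  case: (D (h, h)) => [hh|] //=; lia.
move=> pos i k j; apply: (through _ _ pred0) => //=.
by rewrite mem_enum.
Qed.

(** * Tight closure *)

Definition litv nu i : int := if i.2 then - nu i.1 else nu i.1.

Definition msat M nu := forall i j, ble (Some (litv nu i - litv nu j)) (M (i, j)).

Definition coherent M := forall i j, M (bar j, bar i) = M (i, j).

Lemma barK : involutive (@bar V).
Proof. by case=> v b; rewrite /bar /= negbK. Qed.

Lemma litv_bar nu i : litv nu (bar i) = - litv nu i.
Proof. by case: i => v [] //=; rewrite /litv /= ?opprK. Qed.

(** The closure transposed along [bar] is a candidate for [fw_greatest], hence lies below the
    closure; as [bar] is an involution, the converse inequality follows. *)
Lemma fw_coherent M :
  coherent M -> (forall i, ble (Some 0) (fw M (i, i))) -> coherent (fw M).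
Proof.
move=> cohM pos.
pose X : dbm V := [ffun ij => fw M (bar ij.2, bar ij.1)].
have XE i j : X (i, j) = fw M (bar j, bar i) by rewrite ffunE.
have leX : mx_le X (fw M).
  apply: fw_greatest => [i|i k j|i j]; rewrite !XE.
  - exact: fw_diag_le.
  - move: (fw_triangle pos (bar j) (bar k) (bar i)).
    case: (fw M _) => [a|]; case: (fw M _) => [b|]; case: (fw M _) => [c|] //=; lia.
  - by rewrite -(cohM i j); apply: fw_le.
move=> i j; apply: ble_anti; first by rewrite -XE; apply: leX.
by have := leX (bar j) (bar i); rewrite XE !barK.
Qed.

(** Evenness of unary bounds and strong closure are phrased with [c + c], avoiding division. All
    five properties survive the deletion of variables, so projected matrices need no new closure. *)
Record tightly_closed T : Prop := TightlyClosed {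
  tc_diag : forall i, T (i, i) = Some 0;
  tc_tri : triangle T;
  tc_coh : coherent T;
  tc_even : forall i c, T (i, bar i) = Some c -> exists h : int, c = h + h;
  tc_strong : forall i j (c d : int), T (i, bar i) = Some (c + c) ->
    T (bar j, j) = Some (d + d) -> ble (T (i, j)) (Some (c + d)) }.

Lemma tightenE D i j : (tighten D).1 (i, j) =
  bmin (D (i, j)) (badd (bhalf (D (i, bar i))) (bhalf (D (bar j, j)))).
Proof. by rewrite matrixTE. Qed.

(** [D (i, bar i)] bounds twice a literal, so rounding its half down loses no integer valuation. *)
Lemma msat_tighten D nu : msat (tighten D).1 nu <-> msat D nu.
Proof.
split=> satD i j.
  by apply: ble_trans (satD i j) _; rewrite tightenE ble_bminl.
rewrite tightenE ble_bmin satD /=.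
move: (satD i (bar i)) (satD (bar j) j); rewrite !litv_bar.
by case: (D _) => [a|]; case: (D _) => [b|] //=; lia.
Qed.

(** One tightening needs no second closure after it: halved unary bounds already propagate along
    edges ([half_le]), and the two unary bounds of the middle variable have a nonnegative sum by the
    diagonal test. *)
Lemma tighten_closed M : coherent M ->
    (forall i, ble (Some 0) ((tighten (fw M)).1 (i, i))) ->
  tightly_closed (tighten (fw M)).1.
Proof.
move=> cohM posT; set D := fw M; set T := (tighten D).1.
have posD i : ble (Some 0) (D (i, i)).
  by apply: ble_trans (posT i) _; rewrite tightenE ble_bminl.
have triD : triangle D by apply: fw_triangle.
have cohD : coherent D by apply: fw_coherent.
have evenT i : T (i, bar i) = omap (fun h : int => h + h) (bhalf (D (i, bar i))).
  rewrite tightenE barK; case: (D _) => [c|] //=; congr Some; lia.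
split.
- move=> i; apply: ble_anti (posT i).
  by rewrite tightenE; apply: ble_trans (ble_bminl _ _) (fw_diag_le M i).
(* By coherence [D (i, bar i)] is at most twice [D (i, k)] plus [D (k, bar k)]; rounding the half
   down is harmless because the first summand is even. *)
- have half_le i k : ble (bhalf (D (i, bar i))) (badd (D (i, k)) (bhalf (D (k, bar k)))).
    move: (triD i k (bar i)) (triD k (bar k) (bar i)); rewrite cohD.
    case: (D _) => [a|]; case: (D _) => [b|]; case: (D _) => [c|];
    case: (D _) => [d|] //=; lia.
  move=> i k j; have := posT k; rewrite !tightenE.
  move: (triD i k j) (half_le i k) (half_le (bar j) (bar k)); rewrite !barK cohD.
  case: (D (i, j)) => [ij|]; case: (D (i, k)) => [ik|]; case: (D (k, j)) => [kj|];
  case: (bhalf (D (i, bar i))) => [hi|]; case: (bhalf (D (k, bar k))) => [hk|];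
  case: (bhalf (D (bar j, j))) => [hj|]; case: (bhalf (D (bar k, k))) => [hk'|];
  case: (D (k, k)) => [kk|] //=; lia.
- move=> i j; rewrite !tightenE !barK cohD; congr bmin.
  by case: (bhalf _) => [a|]; case: (bhalf _) => [b|] //=; rewrite addrC.
- by move=> i c; rewrite evenT; case: (bhalf _) => //= h [<-]; exists h.
- move=> i j c d; move: (evenT i) (evenT (bar j)).
  rewrite barK => -> ->; rewrite tightenE.
  case: (bhalf _) => [a|] //; case: (bhalf _) => [b|] //.
  by case: (D _) => [e|] /= [eqc] [eqd]; lia.
Qed.

Lemma msat_fw M nu : msat (fw M) nu <-> msat M nu.
Proof.
split=> satM i j; first exact: ble_trans (satM i j) (fw_le M i j).
pose X : dbm V := [ffun ij => Some (litv nu ij.1 - litv nu ij.2)].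
have XE a b : X (a, b) = Some (litv nu a - litv nu b) by rewrite ffunE.
rewrite -XE; apply: fw_greatest => [a|a b c|a b]; rewrite !XE;
  [|by move=> /=; lia|exact: satM].
by rewrite subrr.
Qed.

Definition tclosure M := (tight_closure M).1.

Lemma tclosureE M : tclosure M =
  if [forall i, ble (Some 0) ((tighten (fw M)).1 (i, i))]
  then Some (tighten (fw M)).1 else None.
Proof. by []. Qed.

Lemma tclosureP M : coherent M ->
  match tclosure M with
  | Some T => tightly_closed T /\ (forall nu, msat T nu <-> msat M nu)
  | None => forall nu, ~ msat M nu
  end.
Proof.
move=> cohM; rewrite tclosureE; case: forallP => [pos|neg].
  split; first exact: tighten_closed.
  by move=> nu; rewrite msat_tighten msat_fw.
move=> nu /msat_fw /msat_tighten satT; apply: neg => i.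
by have := satT i i; rewrite subrr.
Qed.

End Closure.

(** * Integer solutions of tightly closed matrices *)

Section GreedyChoice.
Local Open Scope ring_scope.

(* [v] is as large as the constraints permit, [K] replacing an absent upper bound. *)
Lemma greedy_choice (I : finType) (f g : I -> bound) (K : int) :
    (forall j k, ble (Some 0) (badd (f j) (g k))) ->
  exists v, [/\ forall j, ble (Some v) (f j), forall k, ble (Some (- v)) (g k)
              & K <= v \/ exists j, f j = Some v].
Proof.
move=> fg; have [w [gw Kw]] : exists w, (forall k, ble (Some (- w)) (g k)) /\ K <= w.
  suff [w [gw Kw]] :
      exists w, (forall k, k \in enum I -> ble (Some (- w)) (g k)) /\ K <= w.
    by exists w; split=> // k; apply: gw; rewrite mem_enum.
  elim: (enum I) => [|k s [w [gw Kw]]]; first by exists K.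
  case gk: (g k) => [c|]; last first.
    by exists w; split=> // l; rewrite inE => /orP[/eqP->|/gw //]; rewrite gk.
  exists (Num.max w (- c)); split=> [l|]; last by lia.
  rewrite inE => /orP[/eqP->|/gw]; first by rewrite gk /=; lia.
  by case: (g l) => //= d; lia.
have [v [fv vw vf]] : exists v, [/\ forall j, j \in enum I -> ble (Some v) (f j),
    v <= w & v = w \/ exists j, f j = Some v].
  elim: (enum I) => [|j s [v [fv vw vf]]]; first by exists w; split=> //; left.
  have [le_v|gt_v] := boolP (ble (Some v) (f j)).
    by exists v; split=> // l; rewrite inE => /orP[/eqP->|/fv].
  case fj: (f j) gt_v => [c|] //= gt_v; exists c; split; [|lia|by right; exists j].
  move=> l; rewrite inE => /orP[/eqP->|/fv]; first by rewrite fj /=.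
  by case: (f l) => //= d; lia.
exists v; split=> [j|k|]; first by apply: fv; rewrite mem_enum.
  case: vf => [->|[j fj]]; first exact: gw.
  by have := fg j k; rewrite fj; case: (g k) => //= c; lia.
by case: vf => [->|]; [left|right].
Qed.

End GreedyChoice.

Section Solutions.
Local Open Scope ring_scope.
Variable V : finType.
Implicit Types (M D T X : dbm V) (i j k : lit V) (nu : V -> int).

Definition psat (A : {set V}) T nu := forall i j, i.1 \in A -> j.1 \in A ->
  ble (Some (litv nu i - litv nu j)) (T (i, j)).

(** The upper bound that column [j] puts on the literal [b] once the variables of [A] have values.
    Lower bounds on [b] are upper bounds on [bar b], so one definition covers both. *)
Definition upper T nu (A : {set V}) b j : bound :=
  if j == bar b then bhalf (T (b, bar b))
  else if j.1 \in A then badd (Some (litv nu j)) (T (b, j)) else None.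

Lemma same_var i j : i.1 = j.1 -> i = j \/ i = bar j.
Proof. by case: i j => [v []] [w []] /= ->; auto. Qed.

(** Upper and lower bounds on the new literal are pairwise compatible by the triangle inequality.
    When a unary bound meets a binary one, the inequality holds for doubled quantities, and evenness
    allows it to be halved. The last clause, an extremal choice, is there for [tc_canon]. *)
Lemma psat_extend1 T A nu b (K : int) :
    tightly_closed T -> psat A T nu -> b.1 \notin A ->
  exists nu', [/\ forall x, x != b.1 -> nu' x = nu x, psat (b.1 |: A) T nu'
    & K <= litv nu' b \/ exists j, upper T nu A b j = Some (litv nu' b)].
Proof.
move=> tcT satA bA.
have evenT i : T (i, bar i) = omap (fun h : int => h + h) (bhalf (T (i, bar i))).
  case Ti: (T (i, bar i)) => [c|] //=; have [h ->] := tc_even tcT Ti.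
  by congr Some; lia.
have feas_half c : ble (Some 0) (badd (bhalf (T (c, bar c))) (bhalf (T (bar c, c)))).
  move: (tc_tri tcT c (bar c) c); rewrite (tc_diag tcT) evenT.
  move: (evenT (bar c)); rewrite barK => ->.
  by case: (bhalf _) => [x|]; case: (bhalf _) => [y|] //=; lia.
have feas_mixed c k : k.1 \in A -> ble (Some 0)
    (badd (bhalf (T (c, bar c))) (badd (Some (litv nu k)) (T (bar c, k)))).
  move=> kA; have := satA (bar k) k kA kA; rewrite litv_bar.
  move: (tc_tri tcT (bar k) c k) (tc_tri tcT c (bar c) k).
  rewrite -(tc_coh tcT (bar k) c) barK evenT.
  by case: (bhalf _) => [x|]; case: (T (bar c, k)) => [y|];
    case: (T (bar k, k)) => [z|]; case: (T (c, k)) => [t|] //=; lia.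
have feas j k : ble (Some 0) (badd (upper T nu A b j) (upper T nu A (bar b) k)).
  rewrite /upper barK; case: eqP => [_|_].
    case: eqP => [_|_]; first exact: feas_half.
    case: ifP => // kA; first exact: feas_mixed.
    by case: (bhalf _).
  case: ifP => // jA; case: eqP => [_|_].
    move: (feas_mixed (bar b) j jA); rewrite barK.
    by case: (bhalf _) => [x|]; case: (T _) => [y|] //=; lia.
  case: ifP => // kA; last by case: (T _).
  have := satA (bar k) j kA jA; rewrite litv_bar.
  move: (tc_tri tcT (bar k) b j); rewrite -(tc_coh tcT (bar k) b) barK.
  by case: (T (b, j)) => [x|]; case: (T (bar b, k)) => [y|];
    case: (T (bar k, j)) => [z|] //=; lia.
have [v [vup vlo vK]] := greedy_choice K feas.
pose nu' x := if x == b.1 then (if b.2 then - v else v) else nu x.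
have nu'b : litv nu' b = v by rewrite /litv /nu' eqxx; case: b.2; rewrite ?opprK.
have nu'A j : j.1 \in A -> litv nu' j = litv nu j.
  by move=> jA; rewrite /litv /nu'; case: eqP jA bA => // -> ->.
exists nu'; split=> [x /negbTE nx||]; [by rewrite /nu' nx| |by rewrite nu'b].
have vle j : j.1 \in A -> ble (Some (v - litv nu j)) (T (b, j)).
  move=> jA; have := vup j; rewrite /upper jA.
  have [eqj|_] := eqVneq j (bar b); first by rewrite eqj in jA; rewrite jA in bA.
  by case: (T _) => //= c; lia.
have vge j : j.1 \in A -> ble (Some (- v - litv nu j)) (T (bar b, j)).
  move=> jA; have := vlo j; rewrite /upper jA barK.
  have [eqj|_] := eqVneq j b; first by rewrite eqj in jA; rewrite jA in bA.
  by case: (T _) => //= c; lia.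
have vle2 : ble (Some (v + v)) (T (b, bar b)).
  by have := vup (bar b); rewrite /upper eqxx; case: (T _) => //= c; lia.
have vge2 : ble (Some (- v - v)) (T (bar b, b)).
  by have := vlo b; rewrite /upper barK eqxx; case: (T _) => //= c; lia.
have nu'bb : litv nu' (bar b) = - v by rewrite litv_bar nu'b.
move=> i j; rewrite !inE => /orP[/eqP ib|iA] /orP[/eqP jb|jA].
- case: (same_var ib) => ->; case: (same_var jb) => ->;
    rewrite ?nu'b ?nu'bb ?(tc_diag tcT) //= ?opprK //; lia.
- by rewrite (nu'A j) //; case: (same_var ib) => ->; rewrite ?nu'b ?nu'bb; auto.
- rewrite (nu'A i) //; case: (same_var jb) => ->; rewrite ?nu'b ?nu'bb.
    by have := vge (bar i) iA; rewrite (tc_coh tcT) litv_bar; case: (T _) => //= c; lia.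
  have := vle (bar i) iA; rewrite -(tc_coh tcT i) barK litv_bar.
  by case: (T _) => //= c; lia.
- by rewrite !nu'A //; apply: satA.
Qed.

Lemma psat_extend T A nu : tightly_closed T -> psat A T nu ->
  exists nu', (forall x, x \in A -> nu' x = nu x) /\ msat T nu'.
Proof.
move=> tcT; move eqn: #|~: A| => n; elim: n A nu eqn => [|n IHn] A nu eqn satA.
  exists nu; split=> // i j; have AT x : x \in A.
    by move/eqP: eqn; rewrite cards_eq0 => /eqP/setP/(_ x); rewrite !inE => /negbFE.
  exact: satA.
have /card_gt0P[x] : (0 < #|~: A|)%N by rewrite eqn.
rewrite inE => xA.
have [nu1 [eq1 sat1 _]] := psat_extend1 (b := (x, false)) 0 tcT satA xA.
have [|nu' [eq' sat']] := IHn (x |: A) nu1 _ sat1.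
  have := cardsC A; have := cardsC (x |: A); rewrite cardsU1 xA eqn /=.
  by move=> <-; lia.
exists nu'; split=> // y yA; rewrite eq' ?inE ?yA ?orbT // eq1 //.
by apply: contraNneq xA => /= <-.
Qed.

Lemma psat0 T nu : psat set0 T nu.
Proof. by move=> i j; rewrite inE. Qed.

Lemma tc_solution T : tightly_closed T -> exists nu, msat T nu.
Proof.
by move=> tcT; have [nu [_ satT]] := psat_extend tcT (psat0 T (fun=> 0)); exists nu.
Qed.

(** Each entry is the supremum of a difference of literals over [S], [None] standing for unbounded.
    It depends on [S] only, so matrices computed in different ways can be identified and size bounds
    transferred. *)
Definition canon T (S : (V -> int) -> Prop) := forall i j c,
  ble (T (i, j)) (Some c) <-> forall nu, S nu -> litv nu i - litv nu j <= c.

Lemma canon_le T T' (S S' : (V -> int) -> Prop) :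
  canon T S -> canon T' S' -> (forall nu, S nu -> S' nu) -> mx_le T T'.
Proof.
move=> cT cT' sub i j; case eqT': (T' (i, j)) => [c|]; last by case: (T _).
apply/cT => nu /sub; move: nu; apply/cT'; rewrite eqT'; exact: lexx.
Qed.

Lemma canon_uniq T T' (S S' : (V -> int) -> Prop) :
  canon T S -> canon T' S' -> (forall nu, S nu <-> S' nu) -> T = T'.
Proof.
move=> cT cT' eqS; apply/ffunP => -[i j]; apply: ble_anti.
  by apply: (canon_le cT cT') => nu /eqS.
by apply: (canon_le cT' cT) => nu /eqS.
Qed.

(* To push [y_i - y_j] up to [T (i, j)], first choose [y_i] as large as possible,
   then [y_j] as small as possible. *)
Lemma tc_canon T : tightly_closed T -> canon T (msat T).
Proof.
move=> tcT i j c; split=> [leT nu satT|].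
  by have := satT i j; case: (T _) leT => //= d; lia.
move=> leS; have [//|gtT] := boolP (ble (T (i, j)) (Some c)); exfalso.
have halfE k h : bhalf (T (k, bar k)) = Some h -> T (k, bar k) = Some (h + h).
  case eqT: (T _) => [d|] //= [<-]; have [e ->] := tc_even tcT eqT.
  by congr Some; lia.
have extendi K : exists nu, psat [set i.1] T nu /\
    (K <= litv nu i \/ T (i, bar i) = Some (litv nu i + litv nu i)).
  have [//|nu [_ sat1 maxi]] :=
    psat_extend1 (b := i) K tcT (psat0 T (fun=> 0)) _; first by rewrite inE.
  exists nu; split; first by move: sat1; rewrite setU0.
  case: maxi => [|[k]]; first by left.
  by rewrite /upper inE; case: eqP => // _ /halfE; right.
have [ij|ij] := eqVneq i.1 j.1.
  have [eqj|eqj] := same_var (esym ij); rewrite {j ij}eqj in leS gtT *.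
    have [nu satT] := tc_solution tcT; have := leS _ satT.
    by move: gtT; rewrite (tc_diag tcT) subrr /= => /negbTE ->.
  have [nu [sat1 maxi]] := extendi (`|c| + 1).
  have [nu' [eq' satT]] := psat_extend tcT sat1.
  have := leS _ satT; rewrite litv_bar.
  have -> : litv nu' i = litv nu i by rewrite /litv eq' ?inE.
  by case: maxi gtT => [|->] /=; lia.
have abs_bound (b : bound) :
    exists2 a : int, 0 <= a & forall d : int, b = Some d -> `|d| <= a.
  by case: b => [d|]; [exists `|d| => // e [->] | exists 0].
have [aj aj_ge0 ajP] := abs_bound (bhalf (T (bar j, j))).
have [ai ai_ge0 aiP] := abs_bound (T (bar j, i)).
(* The margins [aj] and [ai] make the difference exceed [c] even if [bar j] is then stopped by its
   unary bound or by its bound relative to [i]. *)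
have [nu [sat1 maxi]] := extendi (`|c| + 1 + aj + ai).
have ji : (bar j).1 \notin [set i.1] by rewrite inE eq_sym.
have [nu1 [eq1 sat2 maxj]] :=
  psat_extend1 (b := bar j) (c + 1 - litv nu i) tcT sat1 ji.
have [nu' [eq' satT]] := psat_extend tcT sat2.
have nui : litv nu' i = litv nu i by rewrite /litv eq' ?eq1 // !inE eqxx orbT.
have nuj : litv nu' j = - litv nu1 (bar j).
  by rewrite litv_bar opprK /litv eq' // !inE eqxx.
have := leS _ satT; rewrite nui nuj.
case: maxj => [|[k]]; first by lia.
rewrite /upper barK inE; case: eqP => [_ eqh|_].
  have Tj := halfE (bar j) _; rewrite barK in Tj; move/Tj: (eqh) => {}Tj.
  case: maxi => [|Ti]; first by have := ajP _ eqh; lia.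
  have := tc_strong tcT Ti Tj; case: (T (i, j)) gtT => //= d; lia.
case: eqP => // /same_var[] -> eqT.
  case: maxi => [|Ti].
    by case: (T (bar j, i)) aiP eqT => //= d /(_ _ erefl) ? [<-]; lia.
  have := tc_tri tcT i (bar i) j; rewrite Ti -(tc_coh tcT (bar i)) barK.
  by case: (T (bar j, i)) eqT => //= d [<-]; case: (T (i, j)) gtT => //= e; lia.
move: eqT gtT; rewrite (tc_coh tcT) litv_bar.
by case: (T (i, j)) => //= d [<-]; lia.
Qed.

End Solutions.

(** * Encoding and projection *)

Definition mbound (V : finType) (B : nat) (M : dbm V) :=
  forall i j c, M (i, j) = Some c -> `|c|%N <= B.

Section Encoding.
Local Open Scope ring_scope.
Variable V : finType.
Implicit Types (M : dbm V) (i j : lit V) (nu : V -> int) (s : seq (atom V)).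

Definition encode_atoms s : dbm V :=
  if encode (OctConj s) is Some M then M else [ffun=> None].

Lemma encode_atoms_cons a s i j : encode_atoms (a :: s) (i, j) =
  if (i, j) \in atom_entries a
  then bmin (Some (atom_const a)) (encode_atoms s (i, j))
  else encode_atoms s (i, j).
Proof. by rewrite !ffunE big_cons. Qed.

Lemma atom_entries_bar a i j :
  ((bar j, bar i) \in atom_entries a) = ((i, j) \in atom_entries a).
Proof.
case: i j => [u []] [v []]; case: a => x y c; rewrite /bar !inE !xpair_eqE /=;
  rewrite ?andbF ?andbT ?orbF //; first [exact: orbC | by rewrite andbC |
  by rewrite orbC; congr orb; rewrite andbC | by congr orb; rewrite andbC].
Qed.

Lemma encode_atoms_coherent s : coherent (encode_atoms s).
Proof.
by move=> i j; elim: s => [|a s IHs]; rewrite ?encode_atoms_cons ?atom_entries_bar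
  ?IHs // !ffunE !big_nil.
Qed.

Lemma entry_atom_sat nu i j (c : int) :
  atom_sat nu (entry_atom (i, j) c) = (litv nu i - litv nu j <= c).
Proof. by case: i j => [u []] [v []]; rewrite /litv /= ?opprK // addrC. Qed.

Lemma atom_sat_entries nu a : atom_sat nu a <-> forall i j,
  (i, j) \in atom_entries a -> litv nu i - litv nu j <= atom_const a.
Proof.
split=> [sat_a i j|sat_a].
  by case: a sat_a => x y c /= sat_a; rewrite !inE => /orP[]/eqP[-> ->];
    move: sat_a; rewrite /litv /=; lia.
by case: a sat_a => x y c /= sat_a;
  [have := sat_a (x, false) (y, false) | have := sat_a (x, false) (y, true)
  |have := sat_a (x, true) (y, false)]; rewrite !inE eqxx /litv /= => /(_ isT); lia.
Qed.

Lemma msat_encode s nu : msat (encode_atoms s) nu <-> all (atom_sat nu) s.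
Proof.
elim: s => [|a s IHs] /=; first by split=> // _ i j; rewrite ffunE big_nil.
split=> [satM|/andP[/atom_sat_entries sat_a /IHs sat_s] i j].
  apply/andP; split.
    apply/atom_sat_entries => i j aij; have := satM i j.
    by rewrite encode_atoms_cons aij ble_bmin => /andP[].
  apply/IHs => i j; have := satM i j; rewrite encode_atoms_cons.
  by case: ifP => // _; rewrite ble_bmin => /andP[].
rewrite encode_atoms_cons; case: ifP => [/sat_a le_a|_]; last exact: sat_s.
by rewrite ble_bmin sat_s andbT.
Qed.

Lemma encode_mbound s : mbound (mu (OctConj s)) (encode_atoms s).
Proof.
elim: s => [|a s IHs] i j c; first by rewrite ffunE big_nil.
have -> : mu (OctConj (a :: s)) = maxn `|atom_const a|%N (mu (OctConj s)).
  by rewrite /= big_cons.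
rewrite encode_atoms_cons leq_max.
case: ifP => [_|_ /IHs ->]; last by rewrite orbT.
case: (bminP (Some (atom_const a)) (encode_atoms s (i, j))) => -> => [[->]|/IHs ->].
  by rewrite leqnn.
by rewrite orbT.
Qed.

Lemma msat_decode M nu : oct_sat nu (decode M) <-> msat M nu.
Proof.
have -> : oct_sat nu (decode M) =
    all (fun ij => ble (Some (litv nu ij.1 - litv nu ij.2)) (M ij))
        (enum {: lit V * lit V}).
  rewrite /= ; elim: (enum _) => //= -[i j] s IHs.
  by case: (M (i, j)) => [c|] //=; rewrite IHs entry_atom_sat.
split=> [/allP sat i j|sat]; first by apply: (sat (i, j)); rewrite mem_enum.
by apply/allP => -[i j] _; apply: sat.
Qed.

Lemma mu_decode B M : mbound B M -> (mu (decode M) <= B)%N.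
Proof.
move=> leB; rewrite /=; elim: (enum _) => [|[i j] s IHs] /=; first by rewrite big_nil.
case eqM: (M (i, j)) => [c|] //=; rewrite big_cons geq_max IHs andbT.
by have := leB i j c eqM; case: i j {eqM} => [u []] [v []].
Qed.

End Encoding.

Section Views.
Local Open Scope ring_scope.

Definition inverse_view (V W : finType) (e : V -> W) (view : W -> option V) :=
  forall w v, view w = Some v <-> w = e v.

Variables (V1 V2 W : finType) (e1 : V1 -> W) (e2 : V2 -> W).
Variables (view1 : W -> option V1) (view2 : W -> option V2).
Hypotheses (ev1 : inverse_view e1 view1) (ev2 : inverse_view e2 view2).

(** Conjunction of two constraints over overlapping sets of variables. Besides composition, it
    builds the unfolding of a power and the pre-image of a domain. *)
Definition join (M1 : dbm V1) (M2 : dbm V2) : dbm W :=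
  (matrixT (fun i j => minT (view_entry view1 M1 i j) (view_entry view2 M2 i j))).1.

Lemma joinE M1 M2 i j : join M1 M2 (i, j) =
  bmin (view_entry view1 M1 i j) (view_entry view2 M2 i j).
Proof. by rewrite /join matrixTE. Qed.

Lemma view_entry_sat (V : finType) (e : V -> W) view (M : dbm V) nu :
  inverse_view e view ->
  (forall i j, ble (Some (litv nu i - litv nu j)) (view_entry view M i j)) <->
  msat M (fun v => nu (e v)).
Proof.
move=> ev; split=> sat => [[v b] [v' b']|[w b] [w' b']].
  have := sat (e v, b) (e v', b'); rewrite /view_entry /=.
  by rewrite (ev _ v).2 // (ev _ v').2.
rewrite /view_entry /=; case eqv: (view w) => [v|] //; case eqv': (view w') => [v'|] //.
by move/ev: eqv => ->; move/ev: eqv' => ->; apply: sat (v, b) (v', b').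
Qed.

Lemma msat_join M1 M2 nu : msat (join M1 M2) nu <->
  msat M1 (fun v => nu (e1 v)) /\ msat M2 (fun v => nu (e2 v)).
Proof.
rewrite -(view_entry_sat _ _ ev1) -(view_entry_sat _ _ ev2).
split=> [sat|[sat1 sat2] i j]; last by rewrite joinE ble_bmin sat1 sat2.
by split=> i j; have := sat i j; rewrite joinE ble_bmin => /andP[].
Qed.

Lemma join_coherent M1 M2 : coherent M1 -> coherent M2 -> coherent (join M1 M2).
Proof.
move=> coh1 coh2 i j; rewrite !joinE /view_entry /=.
congr bmin; case: (_ j.1) => [v|]; case: (_ i.1) => [v'|] //.
  by rewrite -coh1 /bar /= !negbK.
by rewrite -coh2 /bar /= !negbK.
Qed.

Lemma join_mbound B M1 M2 : mbound B M1 -> mbound B M2 -> mbound B (join M1 M2).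
Proof.
move=> B1 B2 i j c; rewrite joinE; case: (bminP (view_entry view1 M1 i j)
  (view_entry view2 M2 i j)) => ->; rewrite /view_entry;
  case: (_ i.1) => [v|] //; case: (_ j.1) => [v'|] //; [exact: B1|exact: B2].
Qed.

End Views.

Section Projection.
Local Open Scope ring_scope.
Variables (V W : finType) (f : V -> W).
Implicit Types (T : dbm W).

Definition subm T : dbm V := (submatrix f T).1.

Lemma submE T i j : subm T (i, j) = T ((f i.1, i.2), (f j.1, j.2)).
Proof. by rewrite /subm matrixTE. Qed.

Lemma subm_tightly_closed T : tightly_closed T -> tightly_closed (subm T).
Proof.
case=> diag tri coh even strong; split.
- by move=> i; rewrite submE diag.
- by move=> i k j; rewrite !submE.
- by move=> i j; rewrite !submE; apply: (coh (f i.1, i.2) (f j.1, j.2)).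
- by move=> i c; rewrite submE; apply: (even (f i.1, i.2)).
- by move=> i j c d; rewrite !submE; apply: (strong (f i.1, i.2) (f j.1, j.2)).
Qed.

Lemma canon_subm T S S' : canon T S ->
  (forall nu, S' nu <-> exists2 nuW, S nuW & forall v, nuW (f v) = nu v) ->
  canon (subm T) S'.
Proof.
have litvE nu nuW (i : lit V) : (forall v, nuW (f v) = nu v) ->
  litv nu i = litv nuW (f i.1, i.2) by move=> eq; rewrite /litv /= eq.
move=> cT eqS i j c; rewrite submE; split.
  move/cT => leT nu /eqS[nuW SnuW eq]; rewrite !(litvE _ _ _ eq); exact: leT.
move=> leS; apply/cT => nuW SnuW; apply: (leS (fun v => nuW (f v))).
by apply/eqS; exists nuW.
Qed.

(** Deleting variables is existential quantification over the integers: a solution of the block is a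
    partial solution of [T], which [psat_extend] completes. *)
Lemma msat_subm T nu : injective f -> tightly_closed T ->
  (msat (subm T) nu <-> exists2 nuW, msat T nuW & forall v, nuW (f v) = nu v).
Proof.
move=> injf tcT; split=> [satT|[nuW satT eq] i j]; last first.
  by have := satT (f i.1, i.2) (f j.1, j.2); rewrite submE /litv /= !eq.
pose nu0 w := if [pick v | f v == w] is Some v then nu v else 0.
have nu0E v : nu0 (f v) = nu v.
  by rewrite /nu0; case: pickP => [u /eqP/injf->|/(_ v)] //; rewrite eqxx.
have [|nuW [eqW satW]] := @psat_extend _ T (f @: setT) nu0 tcT.
  move=> [w b] [w' b'] /imsetP[v _ /= ->] /imsetP[v' _ /= ->].
  by have := satT (v, b) (v', b'); rewrite submE /litv /= !nu0E.
by exists nuW => // v; rewrite eqW ?nu0E // imset_f.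
Qed.

End Projection.

(** * Composition and powers of relations *)

Section Powers.
Variable N : nat.
Implicit Types (S : valuation N -> valuation N -> Prop).

Definition oct_repr (o : option (dbm (var2 N))) S : Prop :=
  match o with
  | Some M => tightly_closed M /\
      forall nu, msat M nu <-> S (fun k => nu (inl k)) (fun k => nu (inr k))
  | None => forall x x', ~ S x x'
  end.

Lemma oct_repr_ext o S S' :
  (forall x x', S x x' <-> S' x x') -> oct_repr o S -> oct_repr o S'.
Proof.
move=> eqS; case: o => [M [tcM satM]|noS x x' /eqS]; last exact: noS.
by split=> // nu; rewrite satM.
Qed.

Lemma drop_z_inj : injective (@drop_z N).
Proof. by case=> [k|k] [l|l] // [->]. Qed.

Definition embed_xz (v : var2 N) : var3 N :=
  match v with inl k => inl k | inr k => inr (inl k) end.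

Lemma in_xzP : inverse_view embed_xz (@in_xz N).
Proof.
move=> w v; split=> [|->]; last by case: v.
by case: w v => [k|[k|k]] [l|l] //= [->].
Qed.

Lemma in_zx'P : inverse_view inr (@in_zx' N).
Proof. by move=> w v; split=> [|-> //]; case: w => [//|w] /= [->]. Qed.

Lemma compose_dbmE (M1 M2 : dbm (var2 N)) : (compose_dbm M1 M2).1 =
  omap (subm (@drop_z N)) (tclosure (join (@in_xz N) (@in_zx' N) M1 M2)).
Proof.
have -> : (compose_dbm M1 M2).1 =
    (if tclosure (join (@in_xz N) (@in_zx' N) M1 M2) is Some T
     then bind (submatrix (@drop_z N) T) (fun A => ret (Some A))
     else ret None).1 by [].
by case: (tclosure _).
Qed.

Lemma compose_repr P Q S1 S2 : oct_repr P S1 -> oct_repr Q S2 ->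
  oct_repr (compose P Q).1 (fun x x' => exists2 z, S1 x z & S2 z x').
Proof.
case: P => [M1 [tc1 sat1]|noS1]; last by move=> _ x x' [z /noS1].
case: Q => [M2 [tc2 sat2]|noS2]; last by move=> x x' [z _ /noS2].
rewrite [compose _ _]/= compose_dbmE.
have := tclosureP (join_coherent (@in_xz N) (@in_zx' N) (tc_coh tc1) (tc_coh tc2)).
case: (tclosure _) => [T [tcT satT]|unsat] /=; last first.
  move=> x x' [z S1xz S2zx']; apply: (unsat (fun w => match w with
    | inl k => x k | inr (inl k) => z k | inr (inr k) => x' k end)).
  by apply/(msat_join in_xzP in_zx'P); split; [apply/sat1|apply/sat2].
split=> [|nu]; first exact: subm_tightly_closed.
rewrite (msat_subm _ drop_z_inj tcT); split=> [[nuW]|[z S1z S2z]].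
  move/satT/(msat_join in_xzP in_zx'P) => [/sat1 S1z /sat2 S2z] eq.
  exists (fun k => nuW (inr (inl k))).
    have <- : (fun k => nuW (inl k)) = (fun k => nu (inl k)).
      by apply: boolp.funext => k; exact: (eq (inl k)).
    exact: S1z.
  have <- : (fun k => nuW (inr (inr k))) = (fun k => nu (inr k)).
    by apply: boolp.funext => k; exact: (eq (inr k)).
  exact: S2z.
exists (fun w => match w with
  | inl k => nu (inl k) | inr (inl k) => z k | inr (inr k) => nu (inr k) end).
  by apply/satT/(msat_join in_xzP in_zx'P); split; [apply/sat1|apply/sat2].
by case.
Qed.

(** Unrolled on the left, so that the domain of power [n.+1] is the pre-image of that of power
    [n]. *)
Fixpoint rpow S n : valuation N -> valuation N -> Prop :=
  if n is n'.+1 then fun x x' => exists2 z, S x z & rpow S n' z x' else eq.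

Lemma rpowD S m n x x' :
  rpow S (m + n) x x' <-> exists2 z, rpow S m x z & rpow S n z x'.
Proof.
elim: m x => [|m IHm] x; first by split=> [|[z -> //]]; exists x.
split=> [[y Sxy /IHm[z Syz Szx']]|[z [y Sxy Syz] Szx']].
  by exists z => //; exists y.
by exists y => //; apply/IHm; exists z.
Qed.

Lemma rpow1 S x x' : rpow S 1 x x' <-> S x x'.
Proof. by split=> [[z ? <-]|] //; exists x'. Qed.

Lemma compose_rpow P Q S m n : oct_repr P (rpow S m) -> oct_repr Q (rpow S n) ->
  oct_repr (compose P Q).1 (rpow S (m + n)).
Proof.
move=> rP rQ; apply: oct_repr_ext (compose_repr rP rQ) => x x'.
by rewrite rpowD.
Qed.

Lemma identity_repr S : oct_repr (Some (identity_dbm N).1) (rpow S 0).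
Proof.
pose index (v : var2 N) := match v with inl k => k | inr k => k end.
have idE i j : (identity_dbm N).1 (i, j) =
  if (index i.1 == index j.1) && (i.2 == j.2) then Some 0%R else None.
  by rewrite /identity_dbm matrixTE.
split.
  split.
  - by move=> i; rewrite idE !eqxx.
  - move=> i k j; rewrite !idE; case: (eqVneq (index i.1) (index k.1)) => [->|_];
      last by case: ifP.
    by case: (eqVneq i.2 k.2) => [->|_]; case: ifP.
  - by move=> [u []] [v []]; rewrite !idE /bar /= [index u == _]eq_sym.
  - by move=> i c; rewrite idE /bar /=; case: i.2; rewrite andbF.
  - by move=> i j c d; rewrite idE /bar /=; case: i.2; rewrite andbF.
move=> nu; split=> [sat|/= eqnu i j].
  apply: boolp.funext => k; have := sat (inl k, false) (inr k, false).
  have := sat (inr k, false) (inl k, false).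
  by rewrite !idE /= !eqxx /litv /=; lia.
rewrite idE; case: ifP => //= /andP[/eqP eqk /eqP eqb].
have nuE v : nu v = nu (inl (index v)).
  by case: v => k //=; rewrite [RHS](congr1 (fun x => x k) eqnu).
by rewrite /litv nuE (nuE j.1) eqk eqb subrr.
Qed.

Lemma tclosure_repr S (M : dbm (var2 N)) : coherent M ->
    (forall nu, msat M nu <-> S (fun k => nu (inl k)) (fun k => nu (inr k))) ->
  oct_repr (tclosure M) (rpow S 1).
Proof.
move=> cohM satM; have := tclosureP cohM.
case: (tclosure M) => [T [tcT satT]|unsat].
  by split=> // nu; rewrite satT satM rpow1.
move=> x x' /rpow1 Sxx'; apply: (unsat (fun v : var2 N => match v with
  | inl k => x k | inr k => x' k end)).
exact/satM.
Qed.

(** The condition on [r] says that it is the exact bit length of [n]. The upper bound on [2 ^ r]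
    keeps [n] positive while rounds remain; this justifies giving up on an inconsistent [Q], which
    is then a factor of the power still to be formed. *)
Lemma fast_exp_loop_repr S r n P Q p q :
    n < 2 ^ r <= n.*2.+1 -> oct_repr P (rpow S p) -> oct_repr Q (rpow S q) ->
  oct_repr (fast_exp_loop r n P Q).1 (rpow S (p + n * q)).
Proof.
elim: r n P Q p q => [|r IHr] n P Q p q.
  by case: n => //= _ rP _; rewrite addn0.
move=> /andP[lt_n le_n] rP rQ.
have n_gt0 : 0 < n by move: le_n; rewrite expnS; have := expn_gt0 2 r; lia.
case: Q rQ => [M rM|noQ]; last first.
  move=> x x'; rewrite -(prednK n_gt0) mulSn addnCA rpowD => -[z Sxz _].
  exact: noQ Sxz.
have -> : p + n * q = (p + odd n * q) + n./2 * (q + q).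
  by rewrite -{1}(odd_double_half n); lia.
have -> : (fast_exp_loop r.+1 n P (Some M)).1 = (fast_exp_loop r n./2
    (if odd n then (compose P (Some M)).1 else P) (compose (Some M) (Some M)).1).1.
  by rewrite [LHS]/=; case: (odd n).
apply: IHr; last exact: compose_rpow.
  by move: lt_n le_n; rewrite expnS; lia.
case: (odd n) => /=; last by rewrite addn0.
by rewrite mul1n; apply: compose_rpow.
Qed.

(** The ceiling of the logarithm is the bit length except at powers of two, where it is one less. *)
Lemma up_log_bits n : 1 < n -> (forall k, n <> 2 ^ k) ->
  n < 2 ^ up_log 2 n <= n.*2.+1.
Proof.
move=> n_gt1 npow; have /andP[lo up] := up_log_bounds (isT : 1 < 2) n_gt1.
have u_gt0 : 0 < up_log 2 n by rewrite up_log_gt0.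
move: lo up (npow (up_log 2 n)) u_gt0; case: (up_log 2 n) => // u /=.
by rewrite expnS; lia.
Qed.

Lemma fast_exp_repr S R n : 0 < n -> (forall k, n <> 2 ^ k) ->
    (if R is Some M then coherent M /\
       forall nu, msat M nu <-> S (fun k => nu (inl k)) (fun k => nu (inr k))
     else forall x x', ~ S x x') ->
  oct_repr (fast_exp R n).1 (rpow S n).
Proof.
move=> n_gt0 npow; case: R => [M [cohM satM]|noS]; last first.
  by case: n n_gt0 {npow} => //= n _ x x' [z /noS].
have n_gt1 : 1 < n by have := npow 0; case: n n_gt0 {npow} => [|[|n]].
have rQ := tclosure_repr cohM satM.
have bits := up_log_bits n_gt1 npow.
have -> : (fast_exp (Some M) n).1 =
    (if tclosure M is None then None else
     (fast_exp_loop (up_log 2 n) n (Some (identity_dbm N).1) (tclosure M)).1).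
  by rewrite /fast_exp /bind /tclosure; case: (tight_closure M).1.
case: (tclosure M) rQ => [T rQ|noQ].
  by have := fast_exp_loop_repr bits (identity_repr S) rQ; rewrite muln1.
by move=> x x'; case: n n_gt1 {npow bits} n_gt0 => //= n _ _ [z /rpow1 /noQ].
Qed.

End Powers.

(** * Size of the closure: walks *)

Section Walks.
Local Open Scope ring_scope.
Variable V : finType.
Implicit Types (M : dbm V) (i j : lit V) (p : seq (lit V)).

Fixpoint weight M i p : bound :=
  if p is j :: p' then badd (M (i, j)) (weight M j p') else Some 0.

Lemma weight_cat M i p q (c d : int) :
  weight M i p = Some c -> weight M (last i p) q = Some d ->
  weight M i (p ++ q) = Some (c + d).
Proof.
elim: p i c => [|j p IHp] i c /=; first by case=> <- ->; rewrite add0r.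
case: (M _) => [e|] //; case eqp: (weight M j p) => [f|] //= [<-] eqq.
by rewrite (IHp _ _ eqp eqq) /= addrA.
Qed.

Lemma weight_split M i p q (c : int) : weight M i (p ++ q) = Some c ->
  exists c1 c2 : int, [/\ weight M i p = Some c1,
    weight M (last i p) q = Some c2 & c = c1 + c2].
Proof.
elim: p i c => [|j p IHp] i c /=; first by move=> eqq; exists 0, c; rewrite add0r.
case: (M _) => [e|] //; case eqpq: (weight M j (p ++ q)) => [f|] //= [<-].
have [c1 [c2 [-> eq2 ->]]] := IHp _ _ eqpq.
by exists (e + c1), c2; rewrite /= addrA.
Qed.

Variable M : dbm V.
Hypothesis posM : forall i, ble (Some 0) (fw M (i, i)).

Lemma fw_weight i p : ble (fw M (i, last i p)) (weight M i p).
Proof.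
elim: p i => [|j p IHp] i /=; first exact: fw_diag_le.
apply: ble_trans (fw_triangle posM i j _) (ble_badd (fw_le M i j) (IHp j)).
Qed.

(** A cycle weighs at least the corresponding diagonal entry of the closure, hence at least 0, so
    cutting it out does not increase the weight. *)
Lemma shorten_walk i p c : weight M i p = Some c -> exists p' c',
  [/\ uniq (i :: p'), last i p' = last i p, weight M i p' = Some c' & c' <= c].
Proof.
elim: p i c => [|j p IHp] i c /=; first by case=> <-; exists [::], 0.
case eqM: (M (i, j)) => [e|] //; case eqp: (weight M j p) => [f|] //= [<-].
have [p' [f' [uniq_p' <- eqp' le_f]]] := IHp _ _ eqp.
have [ip'|ip'] := boolP (i \in j :: p'); last first.
  exists (j :: p'), (e + f'); split=> //; last by lia.
    by rewrite [uniq _]/= ip'.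
  by rewrite /= eqM eqp'.
have eqij : weight M i (j :: p') = Some (e + f') by rewrite /= eqM eqp'.
rewrite -[last j p']/(last i (j :: p')).
case/splitPr: ip' uniq_p' eqij => p1 p2 uniq_p' eqij.
rewrite -cat_rcons in eqij; have [c1 [c2 [eq1]]] := weight_split eqij.
rewrite last_rcons => eq2 eqc.
exists p2, c2; split=> //.
- by move: uniq_p'; rewrite cat_uniq => /and3P[].
- by rewrite last_cat.
- have := fw_weight i (rcons p1 i); rewrite last_rcons eq1.
  by move: (posM i); case: (fw _ _) => [x|] //=; lia.
Qed.

Lemma weight_bound B i p c :
  mbound B M -> weight M i p = Some c -> (`|c| <= size p * B)%N.
Proof.
move=> leB; elim: p i c => [|j p IHp] i c /=; first by case=> <-.
case eqM: (M (i, j)) => [e|] //; case eqp: (weight M j p) => [f|] //= [<-].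
rewrite mulSn; move: (leB _ _ _ eqM) (IHp _ _ eqp).
by move: (size p * B)%N => m; lia.
Qed.

(** A finite entry is the weight of some walk; its shortened form weighs no more, and no less since
    the closure is below every walk. A simple walk has fewer edges than there are literals. *)
Lemma fw_mbound B : mbound B M -> mbound (#|lit V| * B) (fw M).
Proof.
move=> leB i j c eqD.
have [p eqj eqp] : exists2 p, last i p = j & weight M i p = Some c.
  move: i j c eqD; apply: fw_ind => [i|i j c eqM|i k j c d [p eqk eqp] [q eqj eqq]].
  - by exists [::].
  - by exists [:: j] => //=; rewrite eqM /= addr0.
  - exists (p ++ q); first by rewrite last_cat eqk.
    by apply: weight_cat => //; rewrite eqk.
have [p' [c' [uniq_p' eqj' eqp' le_c]]] := shorten_walk eqp.
have : ble (Some c) (Some c') by rewrite -eqp' -eqD -eqj -eqj'; apply: fw_weight.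
move=> /= ge_c; have {le_c ge_c} -> : c = c' by lia.
apply: leq_trans (weight_bound leB eqp') _; rewrite leq_mul2r.
by have := uniq_leq_size uniq_p' (fun x _ => mem_enum (lit V) x); rewrite -cardE /=; lia.
Qed.

End Walks.

Lemma tclosure_mbound (V : finType) B (M T : dbm V) :
  mbound B M -> tclosure M = Some T -> mbound (2 * (#|lit V| * B)) T.
Proof.
rewrite tclosureE; case: forallP => // pos leB [<-].
have posD i : ble (Some 0%R) (fw M (i, i)).
  by apply: ble_trans (pos i) _; rewrite tightenE ble_bminl.
have leD := fw_mbound posD leB; move=> i j c; rewrite tightenE.
case: (bminP (fw M (i, j)) (badd (bhalf (fw M (i, bar i)))
  (bhalf (fw M (bar j, j))))) => -> => [/leD|]; first by lia.
case eqi: (fw M (i, bar i)) => [a|] //; case eqj: (fw M (bar j, j)) => [b|] //= [<-].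
by move: (leD _ _ _ eqi) (leD _ _ _ eqj); move: (_ * B) => m; lia.
Qed.

(** * Unfolding of the powers of a relation *)

Section Unfolding.
Variables (N : nat) (M : dbm (var2 N)) (S : valuation N -> valuation N -> Prop).
Hypothesis cohM : coherent M.
Hypothesis satM : forall nu : var2 N -> int,
  msat M nu <-> S (fun k => nu (inl k)) (fun k => nu (inr k)).

(** Keeping all [k.+1] copies of the variables, with no projection in between, leaves the constants
    of [M] unchanged; the size bound is then linear in [k]. *)
Lemma rpow_unfolding B k : mbound B M ->
  exists (V : finType) (U : dbm V) (f g : 'I_N -> V),
    [/\ injective f, #|V| = N * k.+1, coherent U & mbound B U] /\
    forall x x', rpow S k x x' <->
      exists2 nu, msat U nu & (forall i, nu (f i) = x i) /\ (forall i, nu (g i) = x' i).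
Proof.
move=> leB; elim: k => [|k [V [U [f [g [[injf cardV cohU leU] satU]]]]]].
  exists 'I_N, [ffun=> None], id, id; split.
    split=> //; first by rewrite card_ord muln1.
      by move=> i j; rewrite !ffunE.
    by move=> i j c; rewrite ffunE.
  move=> x x'; split=> [-> |[nu _ [eqx eqx']]].
    by exists x' => // i j; rewrite ffunE.
  by apply: boolp.funext => i; rewrite -eqx.
pose e1 (v : var2 N) : ('I_N + V)%type :=
  match v with inl k => inl k | inr k => inr (f k) end.
pose view1 (w : 'I_N + V) : option (var2 N) :=
  match w with inl k => Some (inl k) | inr v => omap inr [pick u | f u == v] end.
pose view2 (w : 'I_N + V) : option V := if w is inr v then Some v else None.
have ev1 : inverse_view e1 view1.
  move=> w v; split=> [|->].
    case: w => [i [<-] //|w] /=; case: pickP => //= u /eqP <- [<-] //.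
  by case: v => i //=; case: pickP => [u /eqP/injf-> //|/(_ i)]; rewrite eqxx.
have ev2 : inverse_view inr view2.
  by move=> w v; split=> [|-> //]; case: w => // w /= [->].
exists ('I_N + V)%type, (join view1 view2 M U), inl, (fun i => inr (g i)).
split.
  split; first by move=> i j [].
  - by rewrite card_sum card_ord cardV; lia.
  - exact: join_coherent.
  - exact: join_mbound.
move=> x x'; split=> [[z Sxz /satU[nu satnu [eqz eqx']]]|[nu]].
  exists (fun w => match w with inl i => x i | inr v => nu v end).
    apply/(msat_join ev1 ev2); split=> //; apply/satM => /=.
    by have -> : (fun i => nu (f i)) = z by apply: boolp.funext.
  by split.
move/(msat_join ev1 ev2) => [/satM Snu satnu] [/= eqx eqx'].
have eqx1 : (fun i => nu (inl i)) = x by apply: boolp.funext.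
exists (fun i => nu (inr (f i))); first by rewrite -eqx1.
by apply/satU; exists (fun v => nu (inr v)).
Qed.

(** In the factor 4, one 2 counts the literals per variable and the other is the cost of
    tightening. *)
Lemma rpow_canon_mbound B k : mbound B M -> (exists x x', rpow S k x x') ->
  exists2 T, canon T (fun nu => rpow S k (fun i => nu (inl i)) (fun i => nu (inr i)))
           & mbound (4 * N * k.+1 * B) T.
Proof.
move=> leB [x0 [x0' Sx0]].
have [V [U [f [g [[_ cardV cohU leU] satU]]]]] := rpow_unfolding k leB.
have := tclosureP cohU; case eqTU: (tclosure U) => [TU|]; last first.
  by have [nu satnu _] := (satU _ _).1 Sx0; move/(_ nu).
move=> [tcTU satTU]; have leTU := tclosure_mbound leU eqTU.
pose h (v : var2 N) := match v with inl i => f i | inr i => g i end.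
exists (subm h TU).
  apply: canon_subm (tc_canon tcTU) _ => nu.
  rewrite satU; split=> [[nuW satW [eqf eqg]]|[nuW satW eqh]]; exists nuW.
  - exact/satTU.
  - by case.
  - exact/satTU.
  - by split=> i; [apply: (eqh (inl i)) | apply: (eqh (inr i))].
move=> i j c; rewrite submE => /leTU; rewrite card_prod cardV card_bool => le_c.
by apply: leq_trans le_c _; nia.
Qed.

Lemma dom_canon_mbound B k A : mbound B M -> (exists x x', rpow S k x x') ->
  canon A (fun x => exists x', rpow S k x x') -> mbound (4 * N * k.+1 * B) A.
Proof.
move=> leB exS cA; have [T cT leT] := rpow_canon_mbound leB exS.
have -> : A = subm inl T.
  apply: (canon_uniq cA (canon_subm (f := inl) cT (S' := fun x =>
    exists x', rpow S k x x') _)) => // x; split=> [[x' Sxx']|[nu Snu eqx]].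
    by exists (fun v => match v with inl i => x i | inr i => x' i end).
  exists (fun i => nu (inr i)).
  by have <- : (fun i => nu (inl i)) = x by apply: boolp.funext.
by move=> i j c; rewrite submE => /leT.
Qed.

End Unfolding.

(** * Stabilisation of the domains *)

Section Stabilisation.
Local Open Scope ring_scope.
Variables (N : nat) (M : dbm (var2 N)) (S : valuation N -> valuation N -> Prop).
Hypothesis cohM : coherent M.
Hypothesis satM : forall nu : var2 N -> int,
  msat M nu <-> S (fun k => nu (inl k)) (fun k => nu (inr k)).
Variable nu0 : valuation N.
Hypothesis nu0P : forall n, exists x', rpow S n nu0 x'.

Definition primed (v : var2 N) : option 'I_N := if v is inr k then Some k else None.

Lemma primedP : inverse_view inr primed.
Proof. by move=> w v; split=> [|-> //]; case: w => //= w [->]. Qed.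

Lemma SomeP : inverse_view id (@Some (var2 N)).
Proof. by move=> w v; split=> [[]|->]. Qed.

(* [prefix_mx n] describes the domain of the [n]-th power; only shortest paths
   are used to compute it, tightening being postponed to the end. *)
Fixpoint prefix_mx n : dbm 'I_N :=
  if n is n'.+1
  then subm inl (fw (join (@Some (var2 N)) primed M (prefix_mx n')))
  else [ffun=> None].

Definition step_mx n := join (@Some (var2 N)) primed M (prefix_mx n).

Lemma prefix_mxS n i j :
  prefix_mx n.+1 (i, j) = fw (step_mx n) ((inl i.1, i.2), (inl j.1, j.2)).
Proof. by rewrite [prefix_mx _]/= submE. Qed.

(** Eliminating primed variables without tightening is not exact over the integers in general; here
    tightening afterwards gives the block of a tightly closed matrix, and it does not change integer
    solutions. The point [nu0] rules out negative diagonals. *)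
Lemma prefix_mxP n : [/\ coherent (prefix_mx n),
  (forall x, msat (prefix_mx n) x <-> exists x', rpow S n x x') &
  forall i, ble (Some 0) (fw (step_mx n) (i, i))].
Proof.
have sat_step k x x' : (forall x, msat (prefix_mx k) x <-> exists x', rpow S k x x') ->
    msat (step_mx k) (fun v => match v with inl i => x i | inr i => x' i end) <->
    S x x' /\ exists x'', rpow S k x' x''.
  by move=> satk; rewrite (msat_join SomeP primedP) satM -satk.
suff [cohn satn] : coherent (prefix_mx n) /\
    forall x, msat (prefix_mx n) x <-> exists x', rpow S n x x'.
  split=> // i; have [x' [x'' Sxx'' Sx'']] := nu0P n.+1.
  have /msat_fw satD := (sat_step n nu0 x'' satn).2 (conj Sxx'' (ex_intro _ _ Sx'')).
  by have := satD i i; rewrite subrr.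
elim: n => [|n [cohn satn]].
  split=> [i j|x]; first by rewrite !ffunE.
  by split=> [_|_ i j]; [exists x | rewrite ffunE].
have cohW : coherent (step_mx n) by apply: join_coherent.
have := tclosureP cohW; rewrite tclosureE; case: forallP => [pos [tcT satT]|_ unsat].
  have posD i : ble (Some 0) (fw (step_mx n) (i, i)).
    by apply: ble_trans (pos i) _; rewrite tightenE ble_bminl.
  split=> [i j|x]; first rewrite !prefix_mxS.
    exact: (fw_coherent cohW posD (inl i.1, i.2) (inl j.1, j.2)).
  have -> : msat (prefix_mx n.+1) x <-> msat (subm inl (tighten (fw (step_mx n))).1) x.
    (* Tightening at [(i, j)] reads only entries between [i], [j] and their opposites, so it
       commutes with deleting variables. *)
    rewrite -msat_tighten; suff -> : (tighten (prefix_mx n.+1)).1 =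
      subm inl (tighten (fw (step_mx n))).1 by [].
    by apply/ffunP => -[i j]; rewrite submE !tightenE !prefix_mxS.
  have inl_inj : injective (@inl 'I_N 'I_N) by move=> a b [].
  rewrite (msat_subm x inl_inj tcT); split=> [[nu satnu eqx]|[x' [z Sxz Szx']]].
    have eqnu : nu = fun v => match v with inl i => x i | inr i => nu (inr i) end.
      by apply: boolp.funext => -[].
    move/satT: satnu; rewrite eqnu => /(sat_step _ _ _ satn)[Sxz [x' Szx']].
    by exists x', (fun i => nu (inr i)).
  exists (fun v => match v with inl i => x i | inr i => z i end) => //.
  by apply/satT/(sat_step _ _ _ satn); split=> //; exists x'.
have [x' [x'' Sxx'' Sx'']] := nu0P n.+1; exfalso; apply: unsat.
by apply/(sat_step _ _ _ satn); split; [exact: Sxx''|exists x'].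
Qed.

Lemma fw_mono (V : finType) (W W' : dbm V) :
  (forall i, ble (Some 0) (fw W (i, i))) -> mx_le W W' -> mx_le (fw W) (fw W').
Proof.
move=> posW leW; apply: fw_greatest => [i||i j]; first exact: fw_diag_le.
  exact: fw_triangle.
exact: ble_trans (fw_le W i j) (leW i j).
Qed.

Lemma step_mx_le m n : mx_le (prefix_mx m) (prefix_mx n) -> mx_le (step_mx m) (step_mx n).
Proof.
move=> le_mn i j; rewrite !joinE ble_bmin ble_bminl /=.
apply: ble_trans (ble_bminr _ _) _; rewrite /view_entry.
by case: (primed _) => [u|] //; case: (primed _) => [v|].
Qed.

Lemma prefix_mx_anti n t : mx_le (prefix_mx (t + n)) (prefix_mx n).
Proof.
have leS m : mx_le (prefix_mx m.+1) (prefix_mx m).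
  elim: m => [|m IHm] i j; first by rewrite [X in ble _ X]ffunE; case: (prefix_mx _ _).
  rewrite !prefix_mxS; apply: fw_mono; last exact: step_mx_le.
  by have [] := prefix_mxP m.+1.
elim: t => [|t IHt] i j; first exact: ble_refl.
exact: ble_trans (leS _ i j) (IHt i j).
Qed.

Lemma fw_step_anti n t : mx_le (fw (step_mx (t + n))) (fw (step_mx n)).
Proof.
apply: fw_mono; last by apply/step_mx_le/prefix_mx_anti.
by have [] := prefix_mxP (t + n).
Qed.

Lemma fw_step_triangle n : triangle (fw (step_mx n)).
Proof. by apply: fw_triangle; have [] := prefix_mxP n. Qed.

Definition entry := (lit 'I_N * lit 'I_N)%type.
Implicit Types (p q r : entry).

Definition drops n p := ~~ ble (prefix_mx n p) (prefix_mx n.+1 p).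

(* The value of [p] at level [l.+1] is obtained from that of [q] at level [k.+1]
   through a context of weight [c], which can be reused at later levels. *)
Definition linked k q l p (c : int) :=
  (exists2 a : int, prefix_mx k.+1 q = Some a & prefix_mx l.+1 p = Some (a + c)) /\
  forall t, ble (prefix_mx (t + l.+1) p) (badd (prefix_mx (t + k.+1) q) (Some c)).

Lemma linked_trans k q l p m r c d :
  linked k q l p c -> linked l p m r d -> linked k q m r (c + d).
Proof.
move=> [[a eqq eqp] lekl] [[b eqp' eqr] lelm]; split.
  by exists a => //; rewrite eqr; move: eqp'; rewrite eqp => -[<-]; rewrite addrA.
move=> t; apply: ble_trans (lelm t) _; move: (lekl t).
by case: (prefix_mx _ p) => [x|]; case: (prefix_mx _ q) => [y|] //=; lia.
Qed.

(** A walk at level [k.+1] that beats level [k] must use an edge that itself became smaller, that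
    is, a drop of [prefix_mx] at level [k]. The rest of the walk is the context, still available
    later because entries only decrease. *)
Lemma drops_linked k p : drops k.+1 p -> exists q c, drops k q /\ linked k q k.+1 p c.
Proof.
case: p => i j; rewrite /drops !prefix_mxS.
set D := fun n => fw (step_mx n); rewrite -/(D k) -/(D k.+1).
(* Either the weight was already attained or beaten at level [k], or the walk contains a dropping
   edge [q] with the remaining weight [d] as context. *)
pose Phi (i j : lit (var2 N)) c := ble (D k (i, j)) (Some c) \/
  exists q (a d : int), [/\ drops k q, prefix_mx k.+1 q = Some a, c = a + d &
    forall t, ble (D (t + k.+1)%N (i, j)) (badd (prefix_mx (t + k.+1) q) (Some d))].
have PhiD i' j' c : Phi i' j' c -> forall t, ble (D (t + k.+1)%N (i', j')) (Some c).
  move=> [leD|[q [a [d [_ eqa -> leD]]]]] t.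
    by apply: ble_trans leD; rewrite -addSnnS; apply: fw_step_anti.
  apply: ble_trans (leD t) _; have := prefix_mx_anti k.+1 t q.1 q.2.
  by rewrite -surjective_pairing eqa; case: (prefix_mx _ q) => //= b; lia.
have PhiP i' j' c : D k.+1 (i', j') = Some c -> Phi i' j' c.
  move: i' j' c; apply: fw_ind => [a|a b c eqc|a h b c d].
  - by left; apply: fw_diag_le.
  - have [le_c|gt_c] := boolP (ble (step_mx k (a, b)) (Some c)).
      by left; apply: ble_trans (fw_le _ _ _) le_c.
    (* The edge has improved since level [k], so it does not come from [M], which is the same at all
       levels. *)
    have edge : view_entry primed (prefix_mx k.+1) a b = Some c.
      move: eqc gt_c; rewrite !joinE.
      case: (bminP (view_entry Some M a b) (view_entry primed (prefix_mx k.+1) a b))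
        => -> // ->; case/negP; exact: ble_bminl.
    case: a b eqc gt_c edge => [[u|u] s] [[v|v] s'] // eqc gt_c edge; right.
    exists ((u, s), (v, s')), c, 0; split=> //; last move=> t.
    + apply: contra gt_c => le_c; rewrite joinE.
      by apply: ble_trans (ble_bminr _ _) _; move: le_c; rewrite [prefix_mx k.+1 _]edge.
    + by rewrite addr0.
    + apply: ble_trans (fw_le _ _ _) _; rewrite joinE.
      apply: ble_trans (ble_bminr _ _) _; rewrite /view_entry /=.
      by case: (prefix_mx _ _) => //= e; rewrite addr0 lexx.
  (* One dropping edge is enough: if both halves contain one, that of the first half is kept and the
     second half joins the context through [PhiD]. *)
  - move=> Phic Phid; case: (Phic) => [lec|[q [x [e [dropq eqx -> leq]]]]]; last first.
      right; exists q, x, (e + d); split=> //; first by rewrite addrA.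
      move=> t; apply: ble_trans (fw_step_triangle _ a h b) _.
      apply: ble_trans (ble_badd (leq t) (PhiD _ _ _ Phid t)) _.
      by case: (prefix_mx _ _) => //= y; rewrite addrA lexx.
    case: (Phid) => [led|[q [x [e [dropq eqx -> leq]]]]]; last first.
      right; exists q, x, (c + e); split=> //; first by rewrite addrCA.
      move=> t; apply: ble_trans (fw_step_triangle _ a h b) _.
      apply: ble_trans (ble_badd (PhiD _ _ _ Phic t) (leq t)) _.
      by case: (prefix_mx _ _) => //= y; lia.
    left; apply: ble_trans (fw_step_triangle _ a h b) _.
    exact: ble_trans (ble_badd lec led) (ble_refl _).
set I := (inl i.1, i.2); set J := (inl j.1, j.2) => gtD.
case eqD: (D k.+1 (I, J)) gtD => [c|] gtD; last by case: (D k _) gtD.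
case: (PhiP _ _ _ eqD) => [le_c|[q [a [d [dropq eqa eqc leq]]]]].
  by rewrite le_c in gtD.
exists q, d; split=> //; split.
  by exists a => //; rewrite prefix_mxS -/I -/J eqD eqc.
by move=> t; rewrite addnS prefix_mxS; apply: leq.
Qed.

(** A drop at [l] makes the context from [p] to itself negative. Reusing it every [l - k] levels
    drives the entry below the difference of literals at [nu0], a point of every domain. *)
Lemma no_pumping k l p c : (k < l)%N -> linked k p l p c -> ~ drops l p.
Proof.
move=> lt_kl [[a eqk eql] lekl] dropl.
have c_lt0 : c < 0.
  move: dropl; rewrite /drops eql; have := prefix_mx_anti k.+1 (l - k.+1) p.1 p.2.
  rewrite subnK // -surjective_pairing eqk.
  by case: (prefix_mx l p) => //= b; lia.
have pump s : ble (prefix_mx (s * (l - k) + k.+1) p) (Some (a - s%:Z)).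
  elim: s => [|s IHs]; first by rewrite eqk /= subr0 lexx.
  have -> : (s.+1 * (l - k) + k.+1 = s * (l - k) + l.+1)%N by lia.
  apply: ble_trans (lekl _) _; move: IHs.
  by case: (prefix_mx _ _) => //= b; lia.
pose y := litv nu0 p.1 - litv nu0 p.2.
have := pump (`|a|%N + `|y|%N).+1.
have [_ sat0 _] := prefix_mxP ((`|a|%N + `|y|%N).+1 * (l - k) + k.+1).
have := (sat0 nu0).2 (nu0P _) p.1 p.2; rewrite -surjective_pairing -/y.
by case: (prefix_mx _ _) => //= b; lia.
Qed.

(** The drop is traced back to level 0 while [X] collects the entries met on the way; [no_pumping]
    keeps them distinct, so there are at most as many levels as entries. *)
Lemma drops_bound k p (X : {set entry}) : drops k p ->
    (forall x, x \in X -> exists l c, [/\ (k < l)%N, drops l x & linked k p l x c]) ->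
  (#|X| + k < #|{: entry}|)%N.
Proof.
elim: k p X => [|k IHk] p X dropp linkX.
all: have pX : p \notin X by apply/negP => /linkX[l [c [lt_l dropl /no_pumping]]]; apply.
  have := subset_leq_card (subsetT (p |: X)); rewrite cardsU1 pX cardsT.
  by rewrite addn0 add1n.
have [q [c [dropq link_qp]]] := drops_linked dropp.
have := IHk q (p |: X) dropq; rewrite cardsU1 pX => IH; have {IH} := IH _.
rewrite addnS add1n addSn; apply => x; rewrite !inE => /orP[/eqP->|/linkX].
  by exists k.+1, c.
move=> [l [d [lt_l dropl link_px]]]; exists l, (c + d); split=> //; first by lia.
exact: linked_trans link_qp link_px.
Qed.

Lemma dom_stable k x : (4 * N ^ 2 <= k)%N ->
  (exists x', rpow S k x x') <-> (exists x', rpow S (4 * N ^ 2) x x').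
Proof.
move=> le_k; have [_ satk _] := prefix_mxP k; have [_ sat4 _] := prefix_mxP (4 * N ^ 2).
rewrite -satk -sat4; suff -> : prefix_mx k = prefix_mx (4 * N ^ 2) by [].
have card_entry : #|{: entry}| = (4 * N ^ 2)%N.
  by rewrite !card_prod card_ord card_bool; lia.
have stable n : (4 * N ^ 2 <= n)%N -> prefix_mx n.+1 = prefix_mx n.
  move=> le_n; apply/ffunP => -[i j]; apply: ble_anti.
    exact: (prefix_mx_anti n 1 i j).
  have [//|dropp] := boolP (ble (prefix_mx n (i, j)) _).
  have : (#|@set0 entry| + n < #|{: entry}|)%N.
    by apply: drops_bound dropp _ => q; rewrite inE.
  by rewrite cards0 card_entry ltnNge le_n.
rewrite -(subnK le_k); elim: (k - _)%N => //= m IHm.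
by rewrite -[LHS]/(prefix_mx _.+1) stable ?leq_addl.
Qed.

End Stabilisation.

(** * Running time *)

Arguments nat_size : simpl never.

Lemma nat_size_le n k : 0 < k -> n < 2 ^ k -> nat_size n <= k.
Proof.
case: n => [|n] k_gt0 lt_n; first by rewrite /nat_size trunc_log0.
by rewrite /nat_size -(ltn_exp2l _ _ (isT : 1 < 2)) (leq_ltn_trans _ lt_n) ?trunc_logP.
Qed.

Lemma nat_size_mono m n : m <= n -> nat_size m <= nat_size n.
Proof. by move=> le_mn; rewrite /nat_size ltnS leq_trunc_log. Qed.

Lemma ltn_nat_size n : n < 2 ^ nat_size n.
Proof. exact: trunc_log_ltn. Qed.

Lemma bound_size_badd b x y : bound_size x <= b -> bound_size y <= b ->
  bound_size (badd x y) <= b.+1.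
Proof.
case: x y => [c|] [d|] //=; case: b => // b; rewrite ltnS => cb db.
rewrite ltnS in db; rewrite ltnS; apply: nat_size_le => //; rewrite expnS.
have := ltn_nat_size `|c|; have := ltn_nat_size `|d|.
have := leq_pexp2l (isT : 0 < 2) cb; have := leq_pexp2l (isT : 0 < 2) db.
by move: (2 ^ b) (2 ^ _) (2 ^ _); lia.
Qed.

Lemma bound_size_bmin b x y : bound_size x <= b -> bound_size y <= b ->
  bound_size (bmin x y) <= b.
Proof. by move=> xb yb; case: (bminP x y) => ->. Qed.

Lemma bound_size_bhalf b x : bound_size x <= b -> bound_size (bhalf x) <= b.
Proof.
case: x => [c|] //=; apply: leq_trans; rewrite ltnS.
by apply: nat_size_mono; lia.
Qed.

Definition bits (V : finType) b (M : dbm V) := forall i j, bound_size (M (i, j)) <= b.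

Lemma bits_leq (V : finType) b b' (M : dbm V) : b <= b' -> bits b M -> bits b' M.
Proof. by move=> le_b bM i j; apply: leq_trans le_b. Qed.

Lemma mbound_bits (V : finType) B (M : dbm V) : mbound B M -> bits (nat_size B).+1 M.
Proof.
move=> leB i j; case eqM: (M (i, j)) => [c|] //=; rewrite ltnS.
exact/nat_size_mono/(leB _ _ _ eqM).
Qed.

Lemma matrixT_time (V : finType) (f : lit V -> lit V -> timed bound) w :
  (forall i j, (f i j).2 <= w) -> (matrixT f).2 <= #|lit V| ^ 2 * w.
Proof.
move=> le_w; rewrite -mulnn -card_prod -sum_nat_const.
by apply: leq_sum => ij _; apply: le_w.
Qed.

Lemma allT_time (I : finType) (f : I -> timed bool) w :
  (forall i, (f i).2 <= w) -> (Defs.allT f).2 <= #|I| * w.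
Proof.
by move=> le_w; rewrite -sum_nat_const; apply: leq_sum => i _; apply: le_w.
Qed.

Lemma bind_time (A B : Type) (m : timed A) (f : A -> timed B) :
  (bind m f).2 = m.2 + (f m.1).2.
Proof. by []. Qed.

Section ClosureTime.
Variable V : finType.
Implicit Types (M D : dbm V).
Let m := #|lit V|.

Lemma init_diag_bits b M : 1 < b -> bits b M ->
  bits b (init_diag M).1 /\ (init_diag M).2 <= m ^ 2 * (2 * b).
Proof.
move=> b_gt1 bM; split=> [i j|].
  rewrite matrixTE; case: eqP => // _; last exact: bM.
  by rewrite -[(minT _ _).1]/(bmin _ _) bound_size_bmin ?bM.
apply: matrixT_time => i j; have := bM i j.
case: eqP => _; last by rewrite /=; lia.
by rewrite -[(minT _ _).2]/(bound_size _ + 2); lia.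
Qed.

Definition fw_stepT k D : timed (dbm V) :=
  matrixT (fun i j => bind (addT (D (i, k)) (D (k, j)))
                           (fun s => minT (D (i, j)) s)).

Lemma fw_stepT_bits b k D : 0 < b -> bits b D ->
  bits b.+1 (fw_stepT k D).1 /\ (fw_stepT k D).2 <= m ^ 2 * (5 * b).
Proof.
move=> b_gt0 bD; split=> [i j|].
  rewrite [X in bound_size X]fw_stepE; apply: bound_size_bmin.
    exact/leqW/bD.
  exact: bound_size_badd.
apply: matrixT_time => i j; rewrite bind_time.
rewrite -[(addT _ _).2]/(bound_size _ + bound_size _).
rewrite -[(minT _ _).2]/(bound_size _ + bound_size (badd _ _)).
have := bound_size_badd (bD i k) (bD k j); have := bD i j.
by have := bD i k; have := bD k j; lia.
Qed.

(** One extra bit per round holds even with negative cycles, so runs on inconsistent conjunctions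
    are covered too. *)
Lemma fw_foldT_bits s b D : 0 < b -> bits b D ->
  bits (b + size s) (foldT fw_stepT s D).1 /\
  (foldT fw_stepT s D).2 <= size s * (m ^ 2 * (5 * (b + size s))).
Proof.
elim: s b D => [|k s IHs] b D b_gt0 bD; first by rewrite addn0.
have [bD1 time1] := fw_stepT_bits k b_gt0 bD.
have [bF timeF] := IHs b.+1 _ isT bD1; split.
  by apply: bits_leq bF; rewrite /= addSnnS.
rewrite [foldT _ _ _]/= bind_time [size _]/= mulSn; apply: leq_add.
  by apply: leq_trans time1 _; rewrite leq_mul2l; apply/orP; right; lia.
by move: timeF; rewrite addSnnS.
Qed.

Lemma tight_closure_time b M : 0 < m -> 1 < b -> bits b M ->
  (tight_closure M).2 <= 20 * (m ^ 3 * (b + m)).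
Proof.
move=> m_gt0 b_gt1 bM; have [bI timeI] := init_diag_bits b_gt1 bM.
have [bF timeF] := fw_foldT_bits (enum (lit V)) (ltnW b_gt1) bI.
rewrite -cardE -/m in bF timeF.
have eqF : floyd_warshall M = bind (init_diag M) (foldT fw_stepT (enum (lit V))) by [].
have timeD : (floyd_warshall M).2 <= m ^ 2 * (2 * b) + m * (m ^ 2 * (5 * (b + m))).
  by rewrite eqF bind_time leq_add.
have bD : bits (b + m) (fw M) by rewrite /fw eqF.
have bT i j : bound_size ((tighten (fw M)).1 (i, j)) <= (b + m).+1.
  rewrite tightenE; apply: bound_size_bmin; first exact/leqW/bD.
  by apply: bound_size_badd; apply/bound_size_bhalf/bD.
have timeT : (tighten (fw M)).2 <= m ^ 2 * (7 * (b + m)).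
  apply: matrixT_time => i j; rewrite !bind_time.
  rewrite -[(addT _ _).2]/(bound_size (bhalf _) + bound_size (bhalf _)).
  rewrite -[(minT _ _).2]/(bound_size _ + bound_size (badd (bhalf _) (bhalf _))).
  have := bound_size_badd (bound_size_bhalf (bD i (bar i)))
    (bound_size_bhalf (bD (bar j) j)).
  have := bound_size_bhalf (bD i (bar i)); have := bound_size_bhalf (bD (bar j) j).
  by have := bD i j; have := bD i (bar i); have := bD (bar j) j;
    rewrite -![(halfT _).2]/(bound_size _); lia.
have timeA : (Defs.allT (fun i => leT (Some 0%R) ((tighten (fw M)).1 (i, i)))).2 <=
    m * (4 * (b + m)).
  apply: allT_time => i; have := bT i i.
  by rewrite -[(leT _ _).2]/(2 + bound_size _); lia.
have -> : (tight_closure M).2 = (floyd_warshall M).2 + ((tighten (fw M)).2 +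
    ((Defs.allT (fun i => leT (Some 0%R) ((tighten (fw M)).1 (i, i)))).2 + 0)) by [].
move: timeD timeT timeA; move: (floyd_warshall M).2 (tighten _).2 (Defs.allT _).2.
rewrite -/m => tD tT tA; move: (m) m_gt0 => k k_gt0.
have le23 : k ^ 2 * (b + k) <= k ^ 3 * (b + k) by rewrite leq_mul2r leq_pexp2l ?orbT.
have le13 : k * (b + k) <= k ^ 3 * (b + k).
  by rewrite leq_mul2r (leq_pexp2l k_gt0 (isT : 1 <= 3)) orbT.
have : k ^ 2 * b <= k ^ 2 * (b + k) by rewrite leq_mul2l leq_addr orbT.
have eq3 : k * (k ^ 2 * (5 * (b + k))) = 5 * (k ^ 3 * (b + k)).
  by rewrite mulnA -expnS; lia.
have eq2 c x : k ^ 2 * (c * x) = c * (k ^ 2 * x) by rewrite mulnCA.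
rewrite eq3 !eq2 [k * (4 * _)]mulnCA; move: le23 le13.
by move: (k ^ 3 * _) (k ^ 2 * _) (k ^ 2 * _) (k * _); lia.
Qed.

Lemma tclosure_bits b M T : 1 < b -> bits b M -> tclosure M = Some T ->
  bits (b + m).+1 T.
Proof.
move=> b_gt1 bM; have [bI _] := init_diag_bits b_gt1 bM.
have [bF _] := fw_foldT_bits (enum (lit V)) (ltnW b_gt1) bI.
have bD : bits (b + m) (fw M) by rewrite -cardE in bF.
rewrite tclosureE; case: ifP => // _ [<-] i j.
rewrite tightenE; apply: bound_size_bmin; first exact/leqW/bD.
by apply: bound_size_badd; apply/bound_size_bhalf/bD.
Qed.

End ClosureTime.

Lemma submatrix_time (V W : finType) (f : V -> W) (M : dbm W) b :
  bits b M -> (submatrix f M).2 <= #|lit V| ^ 2 * b.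
Proof. by move=> bM; apply: matrixT_time => i j; apply: bM. Qed.

Section PowersTime.
Variable N : nat.
Lemma card_lit2 : #|lit (var2 N)| = 4 * N.
Proof. by rewrite card_prod card_bool card_sum card_ord; lia. Qed.

Lemma card_lit3 : #|lit (var3 N)| = 6 * N.
Proof. by rewrite card_prod card_bool !card_sum card_ord; lia. Qed.

Hypothesis N_gt0 : 0 < N.

(** The factor rounds up 20 * 6^3 * 6 for the closure over 6N literals, plus 2 * 6^2 for the
    conjunction and 7 * 4^2 for the deletion of the middle variables. *)
Definition compose_cost b := 30 * (1000 * (N ^ 3 * (b + N))).

Lemma compose_time b (P Q : option (dbm (var2 N))) : 1 < b ->
  (forall M, P = Some M -> bits b M) -> (forall M, Q = Some M -> bits b M) ->
  (compose P Q).2 <= compose_cost b.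
Proof.
case: P => [M1|] //; case: Q => [M2|] // b_gt1 /(_ _ erefl) bM1 /(_ _ erefl) bM2.
set C := join (@in_xz N) (@in_zx' N) M1 M2.
have bV (V W : finType) (view : W -> option V) (M : dbm V) i j : bits b M ->
    bound_size (view_entry view M i j) <= b.
  move=> bM; rewrite /view_entry; case: (view _) => [u|]; last exact: ltnW.
  by case: (view _) => [v|]; [apply: bM | apply: ltnW].
have bC : bits b C by move=> i j; rewrite joinE; apply: bound_size_bmin; apply: bV.
pose timeC := (matrixT (fun i j => minT (view_entry (@in_xz N) M1 i j)
                                (view_entry (@in_zx' N) M2 i j))).2.
have le_timeC : timeC <= (6 * N) ^ 2 * (2 * b).
  rewrite -card_lit3; apply: matrixT_time => i j /=.
  by have := bV _ _ (@in_xz N) M1 i j bM1; have := bV _ _ (@in_zx' N) M2 i j bM2; lia.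
have le_timeT : (tight_closure C).2 <= 20 * ((6 * N) ^ 3 * (b + 6 * N)).
  by rewrite -card_lit3; apply: tight_closure_time => //; rewrite card_lit3; lia.
pose timeS := if tclosure C is Some T then (submatrix (@drop_z N) T).2 else 0.
have le_timeS : timeS <= (4 * N) ^ 2 * (b + 6 * N).+1.
  rewrite /timeS; case eqT: (tclosure C) => [T|] //; rewrite -card_lit2 -card_lit3.
  exact/submatrix_time/(tclosure_bits b_gt1 bC eqT).
have -> : (compose (Some M1) (Some M2)).2 = timeC + ((tight_closure C).2 + timeS).
  rewrite [compose _ _]/= /compose_dbm !bind_time -/timeC -/C; congr (_ + (_ + _)).
  by rewrite /timeS /tclosure; case: (tight_closure C).1 => //= T; rewrite addn0.
apply: leq_trans (leq_add le_timeC (leq_add le_timeT le_timeS)) _.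
rewrite /compose_cost !expnMn.
have le23 : N ^ 2 * (b + N) <= N ^ 3 * (b + N) by rewrite leq_mul2r leq_pexp2l ?orbT.
have le1 : N ^ 2 * b <= N ^ 2 * (b + N) by rewrite leq_mul2l leq_addr orbT.
have le2 : N ^ 3 * (b + 6 * N) <= 6 * (N ^ 3 * (b + N)).
  by rewrite [X in _ <= X]mulnCA leq_mul2l; lia.
have le3 : N ^ 2 * (b + 6 * N).+1 <= 7 * (N ^ 2 * (b + N)).
  by rewrite [X in _ <= X]mulnCA leq_mul2l; lia.
have eq1 c x y : c * x * (2 * y) = 2 * c * (x * y) by lia.
rewrite eq1 -!(mulnA (_ ^ _) (N ^ _)); move: le1 le2 le3 le23.
rewrite (_ : 6 ^ 2 = 36) // (_ : 6 ^ 3 = 216) // (_ : 4 ^ 2 = 16) //.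
move: (N ^ 3 * (b + N)) (N ^ 3 * (b + 6 * N)) (N ^ 2 * (b + N)).
by move: (N ^ 2 * (b + 6 * N).+1) (N ^ 2 * b); lia.
Qed.

(** The invariant [p + n * q = E] with [n] positive makes both operands powers at most [E], so one
    size [b] serves all rounds. The last squaring may go beyond [E], but its result is never an
    operand. *)
Lemma fast_exp_loop_time (S : valuation N -> valuation N -> Prop) E b r n
    (P Q : option (dbm (var2 N))) p q : 1 < b ->
    (forall k (T : dbm (var2 N)), k <= E -> oct_repr (Some T) (rpow S k) -> bits b T) ->
    n < 2 ^ r <= n.*2.+1 -> p + n * q = E ->
    oct_repr P (rpow S p) -> oct_repr Q (rpow S q) ->
  (fast_exp_loop r n P Q).2 <= r * (2 * compose_cost b + 1 + nat_size n).
Proof.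
move=> b_gt1 bS; elim: r n P Q p q => [|r IHr] n P Q p q //.
move=> /andP[lt_n le_n] eqE rP rQ.
have n_gt0 : 0 < n by move: le_n; rewrite expnS; have := expn_gt0 2 r; lia.
case: Q rQ => [M rM|//].
have le_pE : p <= E by rewrite -eqE leq_addr.
have le_qE : q <= E by rewrite -eqE; nia.
have bM M' : Some M = Some M' -> bits b M' by move=> [<-]; apply: bS rM.
have bP M' : P = Some M' -> bits b M' by move=> eqP; rewrite eqP in rP; apply: bS rP.
pose P' := if odd n then compose P (Some M) else ret P.
have eqE' : (p + odd n * q) + n./2 * (q + q) = E.
  by rewrite -eqE -{3}(odd_double_half n); lia.
have rP' : oct_repr P'.1 (rpow S (p + odd n * q)).
  rewrite /P'; case: (odd n) => /=; last by rewrite addn0.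
  by rewrite mul1n; apply: compose_rpow.
have bits' : n./2 < 2 ^ r <= (n./2).*2.+1 by move: lt_n le_n; rewrite expnS; lia.
have IH := IHr _ _ _ _ _ bits' eqE' rP' (compose_rpow rM rM).
have timeP' : P'.2 <= compose_cost b.
  by rewrite /P'; case: (odd n); [exact: compose_time | exact: leq0n].
have timeQ' : (compose (Some M) (Some M)).2 <= compose_cost b.
  exact: compose_time.
have -> : (fast_exp_loop r.+1 n P (Some M)).2 = 1 + (P'.2 +
    ((compose (Some M) (Some M)).2 + (nat_size n +
    (fast_exp_loop r n./2 P'.1 (compose (Some M) (Some M)).1).2))).
  by [].
have le_half : nat_size n./2 <= nat_size n by apply: nat_size_mono; lia.
have le_r : r * (2 * compose_cost b + 1 + nat_size n./2) <=
    r * (2 * compose_cost b + 1 + nat_size n) by rewrite leq_mul2l leq_add2l le_half orbT.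
move: {IH}(leq_trans IH le_r); rewrite [r.+1 * _]mulSn.
by move: (r * _) timeP' timeQ'; lia.
Qed.

End PowersTime.

Section FastExpTime.
Variables (N : nat) (M : dbm (var2 N)) (S : valuation N -> valuation N -> Prop).
Variable B : nat.
Hypothesis N_gt0 : 0 < N.
Hypothesis cohM : coherent M.
Hypothesis satM : forall nu : var2 N -> int,
  msat M nu <-> S (fun k => nu (inl k)) (fun k => nu (inr k)).
Hypothesis leB : mbound B M.
Let l := N + trunc_log 2 B.

Lemma rpow_repr_canon k T : oct_repr (Some T) (rpow S k) ->
  canon T (fun nu => rpow S k (fun i => nu (inl i)) (fun i => nu (inr i))) /\
  exists x x', rpow S k x x'.
Proof.
move=> [tcT satT]; split.
  move=> i j c; rewrite (tc_canon tcT); split=> le_c nu => [/satT|/satT]; exact: le_c.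
have [nu /satT Snu] := tc_solution tcT.
by exists (fun i => nu (inl i)), (fun i => nu (inr i)).
Qed.

Lemma nat_size_exp2M a c : nat_size (2 ^ a * c) <= a + nat_size c.
Proof.
by apply: nat_size_le; rewrite ?expnD ?ltn_pmul2l ?expn_gt0 ?ltn_nat_size ?addnS.
Qed.

(** The 10 bits per unit of [N] come from [N <= 2 ^ N], [k.+1 <= 2 * 64 ^ N] and [8 <= 8 ^ N]; the
    sign and the rounding of the length fit into the remaining 2. *)
Lemma rpow_repr_bits k T : k <= 64 ^ N -> oct_repr (Some T) (rpow S k) ->
  bits (12 * l) T.
Proof.
move=> le_k /rpow_repr_canon[cT exS].
have [T' cT' leT'] := rpow_canon_mbound cohM satM leB exS.
rewrite (canon_uniq cT cT') //; apply: bits_leq (mbound_bits leT').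
have le_X : 4 * N * k.+1 * B <= 2 ^ (10 * N) * B.
  rewrite leq_mul2r; apply/orP; right.
  have leN : N <= 2 ^ N by apply/ltnW/ltn_expl.
  have -> : 2 ^ (10 * N) = 2 ^ N * (64 ^ N * 8 ^ N).
    by rewrite -!expnMn (expnM 2 10).
  have le8 : 8 <= 8 ^ N by rewrite -{1}(expn1 8) leq_pexp2l.
  have lek2 : k.+1 <= 2 * 64 ^ N.
    have : 0 < 64 ^ N by rewrite expn_gt0.
    by move: (64 ^ N) le_k; lia.
  rewrite -mulnA; apply: leq_trans (leq_mul (leqnn 4) (leq_mul leN lek2)) _.
  have := leq_mul (leqnn (2 ^ N * 64 ^ N)) le8.
  by move: (2 ^ N) (64 ^ N) (8 ^ N); lia.
have := leq_trans (nat_size_mono le_X) (nat_size_exp2M (10 * N) B).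
by rewrite /l /nat_size; lia.
Qed.

Lemma fast_exp_time n : 0 < n -> (forall k, n <> 2 ^ k) -> n <= 64 ^ N ->
  (fast_exp (Some M) n).2 <= 20 * ((4 * N) ^ 3 * (12 * l + 4 * N)) +
    (32 * N ^ 2 + (7 * N + 6 * N * (2 * compose_cost N (12 * l) + 8 * N))).
Proof.
move=> n_gt0 npow le_n.
have n_gt1 : 1 < n by have := npow 0; case: n n_gt0 {npow le_n} => [|[|n]].
have l_gt0 : 0 < l by rewrite /l; lia.
have bM : bits (12 * l) M.
  by apply: bits_leq (mbound_bits leB); rewrite /l /nat_size; lia.
have timeT : (tight_closure M).2 <= 20 * ((4 * N) ^ 3 * (12 * l + 4 * N)).
  by rewrite -card_lit2; apply: tight_closure_time; rewrite ?card_lit2 //; lia.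
have timeI : (identity_dbm N).2 <= 32 * N ^ 2.
  have -> : 32 * N ^ 2 = #|lit (var2 N)| ^ 2 * 2 by rewrite card_lit2 expnMn; lia.
  by apply: matrixT_time => i j; rewrite -[(copyT _).2]/(bound_size _); case: ifP.
have size_n : nat_size n <= 7 * N.
  apply: leq_trans (nat_size_mono le_n) _; apply: nat_size_le; first by lia.
  by rewrite (expnM 2 7); apply: ltn_exp2r.
have up_n : up_log 2 n <= 6 * N.
  by apply: up_log_min => //; rewrite (expnM 2 6).
have rQ := tclosure_repr cohM satM.
have bits_n := up_log_bits n_gt1 npow.
have -> : (fast_exp (Some M) n).2 = (tight_closure M).2 +
    (if tclosure M is None then 0 else (identity_dbm N).2 + (nat_size n +
     (fast_exp_loop (up_log 2 n) n (Some (identity_dbm N).1) (tclosure M)).2)).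
  by rewrite /fast_exp /bind /tclosure; case: (tight_closure M).1.
apply: leq_add timeT _; case: (tclosure M) rQ => [T|//] rQ.
apply: leq_add timeI (leq_add size_n _).
have b_gt1 : 1 < 12 * l by lia.
have := fast_exp_loop_time N_gt0 b_gt1 _ bits_n erefl (identity_repr S) rQ.
rewrite add0n muln1 => timeL; apply: leq_trans (timeL _) _ => [k U le_k|].
  by apply: rpow_repr_bits; apply: leq_trans le_n.
by apply: leq_mul => //; lia.
Qed.

End FastExpTime.

Lemma pow5E e : (pow5 e).1 = 5 ^ e.
Proof. by elim: e => //= e ->; rewrite expnS. Qed.

Lemma pow5_time e : (pow5 e).2 <= 1 + e * nat_size (5 ^ e).
Proof.
elim: e => // e IHe.
have -> : (pow5 e.+1).2 = (pow5 e).2 + nat_size (pow5 e).1 by [].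
have le_size : nat_size (5 ^ e) <= nat_size (5 ^ e.+1).
  by apply: nat_size_mono; rewrite leq_pexp2l.
rewrite pow5E mulSn; have : e * nat_size (5 ^ e) <= e * nat_size (5 ^ e.+1).
  by rewrite leq_mul2l le_size orbT.
by move: IHe le_size; move: (e * _) (e * _); lia.
Qed.

Definition WNT_final N (oV oW : option (dbm (var2 N))) : timed (octagon 'I_N) :=
  match oV, oW with
  | Some MV, Some MW =>
      bind (submatrix inl MV) (fun A => bind (submatrix inl MW) (fun A' =>
        bind (gt_dbm A A') (fun gt => if gt then ret OctFalse else decodeT A)))
  | _, _ => ret OctFalse
  end.

Lemma WNT_outputE N (R : octagon (var2 N)) : WNT_output R =
  (WNT_final (fast_exp (encode R) (5 ^ (2 * N))).1
             (fast_exp (encode R) (5 ^ (2 * N)).+1).1).1.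
Proof. by rewrite -pow5E. Qed.

Lemma WNT_timeE N (R : octagon (var2 N)) : WNT_time R =
  (pow5 (2 * N)).2 + (nat_size (5 ^ (2 * N)) +
  ((fast_exp (encode R) (5 ^ (2 * N))).2 + ((fast_exp (encode R) (5 ^ (2 * N)).+1).2 +
  (WNT_final (fast_exp (encode R) (5 ^ (2 * N))).1
             (fast_exp (encode R) (5 ^ (2 * N)).+1).1).2))).
Proof. by rewrite -pow5E. Qed.

Lemma WNT_final_time N b (oV oW : option (dbm (var2 N))) :
  (forall T, oV = Some T -> bits b T) -> (forall T, oW = Some T -> bits b T) ->
  (WNT_final oV oW).2 <= 7 * ((2 * N) ^ 2 * b).
Proof.
case: oV oW => [T|] [T'|] // /(_ _ erefl) bT /(_ _ erefl) bT'.
have cardN : #|lit 'I_N| = 2 * N by rewrite card_prod card_bool card_ord mulnC.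
have cardN2 : #|{: lit 'I_N * lit 'I_N}| = (2 * N) ^ 2 by rewrite card_prod cardN mulnn.
set A := subm inl T; set A' := subm inl T'.
have bA ij : bound_size (A ij) <= b by case: ij => i j; rewrite submE; apply: bT.
have bA' ij : bound_size (A' ij) <= b by case: ij => i j; rewrite submE; apply: bT'.
have timeV : (submatrix inl T).2 <= (2 * N) ^ 2 * b by rewrite -cardN submatrix_time.
have timeW : (submatrix inl T').2 <= (2 * N) ^ 2 * b by rewrite -cardN submatrix_time.
have time_ge : (Defs.allT (fun ij => leT (A' ij) (A ij))).2 <= (2 * N) ^ 2 * (2 * b).
  rewrite -cardN2 mul2n -addnn; apply: allT_time => ij.
  exact: (leq_add (bA' ij) (bA ij)).
have time_eq : (Defs.allT (fun ij => eqT (A ij) (A' ij))).2 <= (2 * N) ^ 2 * (2 * b).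
  rewrite -cardN2 mul2n -addnn; apply: allT_time => ij.
  exact: (leq_add (bA ij) (bA' ij)).
have timeD : (decodeT A).2 <= (2 * N) ^ 2 * b.
  by rewrite -cardN2 -sum_nat_const; apply: leq_sum => ij _; apply: bA.
have -> : (WNT_final (Some T) (Some T')).2 = (submatrix inl T).2 +
    ((submatrix inl T').2 + (((Defs.allT (fun ij => leT (A' ij) (A ij))).2 +
     ((Defs.allT (fun ij => eqT (A ij) (A' ij))).2 + 0)) +
     (if (gt_dbm A A').1 then ret OctFalse else decodeT A).2)) by [].
have : (if (gt_dbm A A').1 then ret OctFalse else decodeT A).2 <= (2 * N) ^ 2 * b.
  by case: ifP.
move: timeV timeW time_ge time_eq; rewrite ![_ * (2 * b)]mulnCA.
by move: ((2 * N) ^ 2 * b); lia.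
Qed.

(** * Correctness *)

(** Modulo 4 the two exponents are 1 and 2, while powers of two above 2 are 0. This is what
    [up_log_bits] requires. *)
Lemma pow5_not_pow2 N : 0 < N ->
  (forall k, 5 ^ (2 * N) <> 2 ^ k) /\ (forall k, (5 ^ (2 * N)).+1 <> 2 ^ k).
Proof.
move=> N_gt0; have mod4 : 5 ^ (2 * N) %% 4 = 1.
  by rewrite -modnXm exp1n.
have gt1 : 24 < 5 ^ (2 * N) by rewrite (@leq_trans (5 ^ 2)) // leq_pexp2l //; lia.
by split=> -[|[|k]] eqk; move: mod4 gt1 eqk; rewrite ?expn0 ?expn1 ?expnS; lia.
Qed.

Lemma pow5_bounds N : 0 < N ->
  [/\ 4 * N ^ 2 <= 5 ^ (2 * N) & (5 ^ (2 * N)).+1 <= 64 ^ N].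
Proof.
rewrite expnM; elim: N => // -[_ _ //|N] IHN _.
have [//|lo up] := IHN; rewrite !(expnS _ N.+1).
by move: (_ ^ N.+1) (_ ^ N.+1) lo up => x y; split; lia.
Qed.

Section Correctness.
Variables (N : nat) (R : octagon (var2 N)).
Hypothesis N_gt0 : 0 < N.
Let S x x' : Prop := oct_rel R (x, x').
Let n := 5 ^ (2 * N).

Lemma encode_repr :
  if encode R is Some M then [/\ coherent M, mbound (mu R) M &
    forall nu, msat M nu <-> S (fun k => nu (inl k)) (fun k => nu (inr k))]
  else forall x x', ~ S x x'.
Proof.
rewrite /S; case: R => [|s]; first by [].
have eqM : encode (OctConj s) = Some (encode_atoms s) by [].
rewrite eqM; split; [exact: encode_atoms_coherent|exact: encode_mbound|move=> nu].
rewrite msat_encode /oct_rel /= -[X in all (atom_sat X) _ <-> _]/nu.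
have -> // : nu = fun v => match v with inl k => nu (inl k) | inr k => nu (inr k) end.
by apply: boolp.funext => -[].
Qed.

Lemma wrs_rpow nu k : wrs (oct_rel R) nu -> exists nu', rpow S k nu nu'.
Proof.
move=> [X recX Xnu]; elim: k nu Xnu => [|k IHk] nu Xnu; first by exists nu.
have [z Xz Rz] := recX nu Xnu; have [nu' Snu'] := IHk z Xz.
by exists nu', z.
Qed.

(** The domain of power [k] is itself recurrent: a point of the domain of power [k.+1] has a
    successor in it. *)
Lemma dom_fixpoint_wrs nu k :
    (forall x, (exists x', rpow S k x x') -> exists x', rpow S k.+1 x x') ->
  (exists x', rpow S k nu x') -> wrs (oct_rel R) nu.
Proof.
move=> fix_k dom_nu; exists (fun x => exists x', rpow S k x x') => // x /fix_k.
by move=> [x' [z Sxz Szx']]; exists z => //; exists x'.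
Qed.

Lemma fast_exp_encode_repr k : 0 < k -> (forall j, k <> 2 ^ j) ->
  oct_repr (fast_exp (encode R) k).1 (rpow S k).
Proof.
move=> k_gt0 npow; apply: fast_exp_repr => //.
by have := encode_repr; case: (encode R) => // M [].
Qed.

Lemma dom_rpowS x k : (exists x', rpow S k.+1 x x') -> exists x', rpow S k x x'.
Proof.
by move=> [x']; rewrite -addn1 rpowD => -[z Sxz _]; exists z.
Qed.

Lemma dom_repr k T : oct_repr (Some T) (rpow S k) ->
  [/\ forall x, msat (subm inl T) x <-> exists x', rpow S k x x',
      canon (subm inl T) (fun x => exists x', rpow S k x x')
    & exists x x', rpow S k x x'].
Proof.
move=> [tcT satT].
have inl_inj : injective (@inl 'I_N 'I_N) by move=> a b [].
have satA x : msat (subm inl T) x <-> exists x', rpow S k x x'.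
  rewrite (msat_subm x inl_inj tcT); split=> [[nu /satT Snu eqx]|[x' Sxx']].
    exists (fun i => nu (inr i)).
    by have <- : (fun i => nu (inl i)) = x by apply: boolp.funext.
  exists (fun v => match v with inl i => x i | inr i => x' i end) => //.
  exact/satT.
have tcA : tightly_closed (subm inl T) := subm_tightly_closed inl tcT.
split=> //; last by have [x /satA] := tc_solution tcA; exists x.
by move=> i j c; rewrite (tc_canon tcA); split=> le_c x /satA; apply: le_c.
Qed.

Lemma wrs_dom_stable nu k x : wrs (oct_rel R) nu -> 4 * N ^ 2 <= k ->
  (exists x', rpow S k x x') <-> (exists x', rpow S (4 * N ^ 2) x x').
Proof.
move=> wrs_nu; have nuP k' := wrs_rpow k' wrs_nu.
have := encode_repr; case: (encode R) => [M [cohM _ satM]|noS].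
  exact: dom_stable cohM satM nu nuP k x.
by have [x' [z /noS]] := nuP 1.
Qed.

Lemma gt_dbmE (V : finType) (A A' : dbm V) :
  mx_le A' A -> (gt_dbm A A').1 = (A != A').
Proof.
move=> leA; rewrite /gt_dbm /= (introT forallP) => [|[i j]]; last exact: leA.
congr (~~ _); apply/forallP/eqP => [eqA|-> ij]; last exact: eqxx.
by apply/ffunP => ij; apply/eqP.
Qed.

(** Domains decrease, so the test for a strictly larger matrix is a test for inequality. Unequal
    blocks exclude any recurrent point, since one would have stabilised the domains before [n];
    equal blocks make the domain recurrent. *)
Lemma WNT_correct : oct_set (WNT_output R) = wrs (oct_rel R) /\
  mu (WNT_output R) <= 4 * N * (4 * N ^ 2).+1 * mu R.
Proof.
have [npow npowS] := pow5_not_pow2 N_gt0; have [le_n _] := pow5_bounds N_gt0.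
have n_gt0 : 0 < n by rewrite expn_gt0.
have reprV := fast_exp_encode_repr n_gt0 npow.
have reprW := fast_exp_encode_repr (ltn0Sn n) npowS.
rewrite WNT_outputE -/n.
case: (fast_exp (encode R) n).1 reprV => [T|] reprV; last first.
  split=> //; apply/seteqP; split=> [nu //|nu wrs_nu].
  by have [nu' /reprV] := wrs_rpow n wrs_nu.
case: (fast_exp (encode R) n.+1).1 reprW => [T'|] reprW; last first.
  split=> //; apply/seteqP; split=> [nu //|nu wrs_nu].
  by have [nu' /reprW] := wrs_rpow n.+1 wrs_nu.
have [satA canA exA] := dom_repr reprV; have [satA' canA' exA'] := dom_repr reprW.
set A := subm inl T in satA canA; set A' := subm inl T' in satA' canA'.
have -> : (WNT_final (Some T) (Some T')).1 =
  (if (gt_dbm A A').1 then ret OctFalse else decodeT A).1 by [].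
rewrite gt_dbmE; last by apply: (canon_le canA' canA) => x; apply: dom_rpowS.
case: eqVneq => [eqA|neA] /=; last first.
  split=> //; apply/seteqP; split=> [nu //|nu wrs_nu]; case/eqP: neA.
  apply: (canon_uniq canA canA') => x.
  by rewrite !(wrs_dom_stable _ wrs_nu) //; apply: leqW.
have fix_n x : (exists x', rpow S n x x') -> exists x', rpow S n.+1 x x'.
  by rewrite -satA -satA' eqA.
split.
  apply/seteqP; split=> [nu /msat_decode/satA dom_nu|nu /(wrs_rpow n)/satA satnu].
    exact: dom_fixpoint_wrs dom_nu.
  exact/msat_decode.
(* A nonempty output provides a recurrent point, so the output block is also canonical for power
   [4 * N ^ 2]; bounding it at power [n] instead would give constants of order 25^N. *)
have [x0 dom_x0] := exA; have wrs_x0 := dom_fixpoint_wrs fix_n dom_x0.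
have := encode_repr; case: (encode R) => [M [cohM leM satM]|noS]; last first.
  by have [x' [z /noS]] := wrs_rpow 1 wrs_x0.
apply: mu_decode; apply: (dom_canon_mbound cohM satM leM).
  by exists x0; apply: wrs_rpow.
move=> i j c; rewrite canA; split=> le_c x.
  by move/(wrs_dom_stable x wrs_x0 le_n).2; apply: le_c.
by move/(wrs_dom_stable x wrs_x0 le_n).1; apply: le_c.
Qed.

End Correctness.

(** * Total running time and final bounds *)

Lemma WNT_time_bound : exists C, forall N (R : octagon (var2 N)), 0 < N ->
  WNT_time R <= C * (N ^ 4 * (N + trunc_log 2 (mu R))).
Proof.
(* One composition costs O(N^3 l), where [l] bounds both [N] and, up to a constant, the entry
   length; the fourth power of [N] comes from the O(N) rounds. *)
have [K costK] : exists K, forall N l, N <= l ->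
    compose_cost N (12 * l) <= K * (N ^ 3 * l).
  exists (30 * (1000 * 13)) => N l le_Nl; rewrite /compose_cost.
  have : N ^ 3 * (12 * l + N) <= N ^ 3 * (13 * l) by rewrite leq_mul2l; lia.
  by rewrite [X in _ <= X]mulnCA; move: (N ^ 3 * _) (N ^ 3 * _); lia.
have [E fastE] : exists E, forall N l, 0 < N -> N <= l ->
    20 * ((4 * N) ^ 3 * (12 * l + 4 * N)) + (32 * N ^ 2 + (7 * N +
      6 * N * (2 * compose_cost N (12 * l) + 8 * N))) <= E * (N ^ 4 * l).
  exists (20 * (64 * 16) + 32 + 7 + 12 * K + 48) => N l N_gt0 le_Nl.
  have le_cost := costK N l le_Nl; move: (compose_cost _ _) le_cost => c le_c.
  have l_gt0 : 0 < l by apply: leq_trans le_Nl.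
  have le_U a : a <= 4 -> N ^ a <= N ^ 4 * l.
    by move=> le_a; rewrite -[N ^ a]muln1 leq_mul // leq_pexp2l.
  have le3 : N ^ 3 * l <= N ^ 4 * l by rewrite leq_mul2r leq_pexp2l ?orbT.
  have le_T : (4 * N) ^ 3 * (12 * l + 4 * N) <= 64 * (16 * (N ^ 4 * l)).
    rewrite expnMn (_ : 4 ^ 3 = 64) // -mulnA leq_mul2l orFb.
    apply: leq_trans (_ : N ^ 3 * (16 * l) <= _); first by rewrite leq_mul2l; lia.
    by rewrite mulnCA leq_mul2l.
  have le_L : 6 * N * (2 * c + 8 * N) <= (12 * K + 48) * (N ^ 4 * l).
    have : N * c <= K * (N ^ 4 * l).
      apply: leq_trans (_ : N * (K * (N ^ 3 * l)) <= _).
        by rewrite leq_mul2l le_c orbT.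
      by rewrite mulnCA [N * (N ^ 3 * l)]mulnA -expnS.
    have := le_U 2 isT; rewrite -mulnn.
    have -> : 6 * N * (2 * c + 8 * N) = 12 * (N * c) + 48 * (N * N) by lia.
    rewrite mulnDl -(mulnA 12); move: (N ^ 4 * l) => U.
    by move: (N * c) (N * N) (K * U) => x y z; lia.
  have := le_U 1 isT; have := le_U 2 isT; rewrite expn1.
  move: le_T le_L; move: ((4 * N) ^ 3 * _) (6 * N * _) (N ^ 2) => t u v.
  by move: (N ^ 4 * l) => U; rewrite !mulnDl; move: (12 * K * U); lia.
exists (1 + 14 + 7 + 2 * E + 7 * (4 * 12)) => N R N_gt0.
set l := N + trunc_log 2 (mu R).
have le_Nl : N <= l by apply: leq_addr.
have l_gt0 : 0 < l by apply: leq_trans le_Nl.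
have le_U a : a <= 4 -> N ^ a <= N ^ 4 * l.
  by move=> le_a; rewrite -[N ^ a]muln1 leq_mul // leq_pexp2l.
have [npow npowS] := pow5_not_pow2 N_gt0; have [_ le_n] := pow5_bounds N_gt0.
have n_gt0 : 0 < 5 ^ (2 * N) by rewrite expn_gt0.
have size_n : nat_size (5 ^ (2 * N)) <= 7 * N.
  apply: leq_trans (nat_size_mono (ltnW le_n)) _; apply: nat_size_le; first by lia.
  by rewrite (expnM 2 7); apply: ltn_exp2r.
have time_n := leq_trans (pow5_time (2 * N)) (leq_add (leqnn 1)
  (leq_mul (leqnn (2 * N)) size_n)).
have time_exp k : 0 < k -> (forall j, k <> 2 ^ j) -> k <= 64 ^ N ->
    (fast_exp (encode R) k).2 <= E * (N ^ 4 * l).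
  move=> k_gt0 npow_k le_k; have := encode_repr R.
  case: (encode R) => [M [cohM leM satM]|//].
  apply: leq_trans (fast_exp_time (S := fun x x' => oct_rel R (x, x'))
    N_gt0 cohM satM leM k_gt0 npow_k le_k) _.
  exact: (fastE N l N_gt0 le_Nl).
have bits_exp k T : 0 < k -> (forall j, k <> 2 ^ j) -> k <= 64 ^ N ->
    (fast_exp (encode R) k).1 = Some T -> bits (12 * l) T.
  move=> k_gt0 npow_k le_k eqT; have := fast_exp_encode_repr R k_gt0 npow_k.
  rewrite eqT; have := encode_repr R; case: (encode R) eqT => [M|] // _.
  move=> [cohM leM satM]; exact: (rpow_repr_bits N_gt0 cohM satM leM le_k).
have time_f : (WNT_final (fast_exp (encode R) (5 ^ (2 * N))).1
    (fast_exp (encode R) (5 ^ (2 * N)).+1).1).2 <= 7 * ((2 * N) ^ 2 * (12 * l)).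
  by apply: WNT_final_time => T; apply: bits_exp => //; apply: ltnW.
have := time_exp _ n_gt0 npow (ltnW le_n).
have := time_exp _ (ltn0Sn _) npowS le_n.
have le_f : (2 * N) ^ 2 * (12 * l) <= 4 * (12 * (N ^ 4 * l)).
  rewrite expnMn (_ : 2 ^ 2 = 4) // -mulnA leq_mul2l orFb mulnCA leq_mul2l orFb.
  by rewrite leq_mul2r leq_pexp2l ?orbT.
rewrite WNT_timeE; move: time_n size_n time_f le_f (le_U 0 isT) (le_U 1 isT) (le_U 2 isT).
rewrite expn0 expn1 -(mulnn N).
move: (pow5 _).2 (nat_size _) (fast_exp _ _).2 (fast_exp _ _).2 (WNT_final _ _).2.
move: ((2 * N) ^ 2 * _) (N ^ 4 * l) => g U t1 t2 t3 t4 t5.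
by rewrite !mulnDl; lia.
Qed.

Lemma sqrn_leq_exp2 N : N ^ 2 <= 4 * 2 ^ N.
Proof.
have [|le3N] := ltnP N 3; first by case: N => [|[|[|]]].
rewrite -(subnK le3N); elim: (N - 3) => // m; rewrite addSn (expnS 2).
move: (m + 3) (leq_addl m 3) => x le3x.
have : 3 * x <= x * x by rewrite leq_mul2r le3x orbT.
by move: (2 ^ x); rewrite -!mulnn; lia.
Qed.

Theorem theorem4p38 :
  exists Ctime Cmu : nat,
  forall (N : nat) (R : octagon (var2 N)), 0 < N ->
    [/\ oct_set (WNT_output R) = wrs (oct_rel R),
        WNT_time R <= Ctime * (N ^ 4 * (N + trunc_log 2 (mu R)))
      & mu (WNT_output R) <= Cmu * (mu R * N * 2 ^ N)].
Proof.
have [Ctime timeC] := WNT_time_bound; exists Ctime, 80 => N R N_gt0.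
have [-> le_mu] := WNT_correct R N_gt0; split; [by []|exact: timeC|].
apply: leq_trans le_mu _; have := sqrn_leq_exp2 N.
have : 0 < 2 ^ N by rewrite expn_gt0.
move: (N ^ 2) (2 ^ N) => x y y_gt0 le_xy.
(* With [x <= 4 * y] and [y] positive the factor is at most 68y, so 80 suffices; the cubic bound in
   [N] is weakened to the stated exponential form. *)
have : N * mu R * (4 * (4 * x).+1) <= N * mu R * (80 * y) by rewrite leq_mul2l; lia.
by lia.
Qed.
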